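(* Let $\mathfrak{g}$ be a $4$-dimensional real Lie algebra carrying a hypersymplectic structure. Then $\mathfrak{g}$ is isomorphic to either $\mathbb{R}^4$, $\mathfrak{g}^h_0$, $\mathfrak{g}^h_1$ or $\mathfrak{g}^h_2$. Furthermore, the parametrization of the underlying complex product structures $\{J,E\}$ of hypersymplectic structures $\{J,E,g\}$ on $\mathfrak g$ is, in each case, the following. (i) If $\mathfrak{g}\cong\mathbb{R}^4$, the underlying complex product structure is equivalent to $\{J,E\}$, where $$J=\begin{pmatrix} 0 & -\mathbf{1} \\ \mathbf{1} & 0 \end{pmatrix},\quad E=\begin{pmatrix} \mathbf{1} & 0 \\ 0 & -\mathbf{1} \end{pmatrix}$$ (with $\mathbf{1}$ the $2\times 2$ identity matrix) in some ordered basis of $\mathbb{R}^4$. (ii) If $\mathfrak{g}\cong\mathfrak{g}^h_0$, then the underlying complex product structure on $\mathfrak{g}$ is equivalent to one and only one of $\{J^{(0)},E^{(0)}_{\theta}\}$, where $$J^{(0)}=\begin{pmatrix} 0&-1&0&0\\1&0&0&0\\0&0&0&-1\\0&0&1&0\end{pmatrix},\quad E^{(0)}_{\theta}=\begin{pmatrix}1&0&0&0\\0&-1&0&0\\0&0&\cos\theta&\sin\theta\\0&0&\sin\theta&-\cos\theta\end{pmatrix}$$ for $\theta\in[0,2\pi)$, in the ordered basis $\{v_1,v_2,v_3,v_0\}$ of $\mathfrak g^h_0$. (iii) If $\mathfrak{g}\cong\mathfrak{g}^h_1$, then the underlying complex product structure on $\mathfrak{g}$ is equivalent to one and only one of $\{J^{(1)},E^{(1)}_{\theta,d}\}$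 or $\{J^{(1)},E^{(1)}_1\}$, where $$J^{(1)}=\begin{pmatrix} 0&-1&0&0\\1&0&0&0\\0&0&0&-1\\0&0&1&0\end{pmatrix},$$ $$E^{(1)}_{\theta,d}=\begin{pmatrix}\cos\theta&\sin\theta&0&0\\ \sin\theta&-\cos\theta&0&0\\ -d\sin\theta&d(1+\cos\theta)&1&0\\ d(1+\cos\theta)&d\sin\theta&0&-1\end{pmatrix},\quad E^{(1)}_1=\begin{pmatrix}-1&0&0&0\\0&1&0&0\\-2&0&1&0\\0&2&0&-1\end{pmatrix}$$ for $\theta\in[0,2\pi)$ and $d=0$ or $d=1$, in the ordered basis $\{v_0,v_1,v_2,v_3\}$ of $\mathfrak g^h_1$. (iv) If $\mathfrak{g}\cong\mathfrak{g}^h_2$, then the underlying complex product structure on $\mathfrak{g}$ is equivalent to one and only one of $\{J^{(2)},E^{(2)}_{\theta,d}\}$ or $\{J^{(2)},E^{(2)}_1\}$, where $$J^{(2)}=\begin{pmatrix} 0&1&0&0\\-1&0&0&0\\0&0&0&-1\\0&0&1&0\end{pmatrix},$$ $$E^{(2)}_{\theta,d}=\begin{pmatrix}\cos\theta&\sin\theta&0&0\\ \sin\theta&-\cos\theta&0&0\\ d\sin\theta(1+\cos\theta)&-d\cos\theta(1+\cos\theta)&\cos\theta&-\sin\theta\\ d\cos\theta(1+\cos\theta)&d\sin\theta(1+\cos\theta)&-\sin\theta&-\cos\theta\end{pmatrix},\quad E^{(2)}_1=\begin{pmatrix}-1&0&0&0\\0&1&0&0\\0&2&-1&0\\-2&0&0&1\end{pmatrix}$$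 for $\theta\in[0,2\pi)$ and $d=0$ or $d=1$, in the ordered basis $\{v_0,v_2,v_1,v_3\}$ of $\mathfrak g^h_2$.
   Context: All Lie algebras are finite-dimensional over $\mathbb{R}$. A complex structure on a Lie algebra $\mathfrak{g}$ is a linear endomorphism $J$ with $J^2=-\mathrm{Id}$ and $J[x,y]=[Jx,y]+[x,Jy]+J[Jx,Jy]$ for all $x,y\in\mathfrak g$. A product structure is a linear endomorphism $E$, $E\neq\pm\mathrm{Id}$, with $E^2=\mathrm{Id}$ and $E[x,y]=[Ex,y]+[x,Ey]-E[Ex,Ey]$ for all $x,y$ (equivalently, the $\pm1$-eigenspaces of $E$ are Lie subalgebras). A complex product structure on $\mathfrak{g}$ is a pair $\{J,E\}$ of a complex structure $J$ and a product structure $E$ with $JE=-EJ$. A metric on $\mathfrak g$ is a nondegenerate symmetric bilinear form $g:\mathfrak g\times\mathfrak g\to\mathbb R$; it is compatible with $\{J,E\}$ if $g(Jx,Jy)=g(x,y)$ and $g(Ex,Ey)=-g(x,y)$ for all $x,y$. Then $\omega_1(x,y)=g(Jx,y)$, $\omega_2(x,y)=g(Ex,y)$, $\omega_3(x,y)=g(JEx,y)$ are skew-symmetric. A 2-form $\omega$ is closed if $-\omega([x,y],z)+\omega([x,z],y)-\omega([y,z],x)=0$ for all $x,y,z$. If $g$ is compatible with $\{J,E\}$ and $\omega_1,\omega_2,\omega_3$ are closed, $\{J,E,g\}$ is a hypersymplectic structure on $\mathfrak g$, and $\{J,E\}$ is its underlying complex product structure. Two complex product structures $\{J,E\}$ on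 $\mathfrak g$ and $\{J',E'\}$ on $\mathfrak g'$ are equivalent if there is a Lie algebra isomorphism $\xi:\mathfrak g\to\mathfrak g'$ with $\xi J=J'\xi$ and $\xi E=E'\xi$. $\mathbb R^4$ denotes the abelian Lie algebra. The following Lie algebras have basis $\{v_0,v_1,v_2,v_3\}$, with only the listed brackets (and those obtained by skew-symmetry) nonzero: - $\mathfrak{g}^h_0$: $[v_1,v_2]=v_3$; - $\mathfrak{g}^h_1$: $[v_0,v_1]=v_1$, $[v_0,v_2]=-v_2$, $[v_0,v_3]=-v_3$; - $\mathfrak{g}^h_2$: $[v_0,v_1]=2v_1$, $[v_0,v_2]=-v_2$, $[v_0,v_3]=v_3$, $[v_1,v_2]=v_3$. Matrices act on column vectors of coordinates: the $j$-th column gives the image of the $j$-th vector of the ordered basis. Note that $E^{(1)}_{\pi,0}=E^{(1)}_{\pi,1}$ and $E^{(2)}_{\pi,0}=E^{(2)}_{\pi,1}$; coinciding structures in the lists are regarded as the same structure. *)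

(* Defs.v *)
From HB Require Import structures.
From mathcomp Require Import all_boot all_order all_algebra.
From mathcomp Require Import ring.
From mathcomp Require Import boolp classical_sets set_interval reals trigo.

Set Implicit Arguments.
Unset Strict Implicit.
Unset Printing Implicit Defensive.

Import Order.TTheory GRing.Theory Num.Theory.

Local Open Scope classical_set_scope.
Local Open Scope ring_scope.

HB.mixin Record isLieAlgebra (R : fieldType) V of GRing.Lmodule R V := {
  lie : V -> V -> V;
  lie_linearl : forall y, linear (lie ^~ y);
  lie_linearr : forall x, linear (lie x);
  liexx : forall x, lie x x = 0;
  lie_jacobi : forall x y z,
    lie x (lie y z) + lie y (lie z x) + lie z (lie x y) = 0
}.

#[short(type="lieAlgType")]
HB.structure Definition LieAlgebra (R : fieldType) :=
  {V of Vector R V & isLieAlgebra R V}.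

Section Structures.
Context {R : realType} {g : lieAlgType R}.
Implicit Types (J E : 'End(g)) (m : {symmetric g}).

Definition complex_structure J : Prop :=
  (forall x, J (J x) = - x) /\
  (forall x y, J (lie x y) = lie (J x) y + lie x (J y) + J (lie (J x) (J y))).

Definition product_structure E : Prop :=
  [/\ E <> \1%VF, E <> - \1%VF,
      forall x, E (E x) = x &
      forall x y, E (lie x y) = lie (E x) y + lie x (E y) - E (lie (E x) (E y))].

Definition complex_product_structure J E : Prop :=
  [/\ complex_structure J, product_structure E &
      forall x, J (E x) = - E (J x)].

Definition compatible J E m : Prop :=
  (forall x y, m (J x) (J y) = m x y) /\
  (forall x y, m (E x) (E y) = - m x y).

Definition closed_form (w : g -> g -> R) : Prop :=
  forall x y z, - w (lie x y) z + w (lie x z) y - w (lie y z) x = 0.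

Definition hypersymplectic J E m : Prop :=
  [/\ complex_product_structure J E,
      nondegenerate m /\ compatible J E m,
      closed_form (fun x y => m (J x) y),
      closed_form (fun x y => m (E x) y) &
      closed_form (fun x y => m (J (E x)) y)].

Definition underlying_cps J E : Prop := exists m, hypersymplectic J E m.

End Structures.

Lemma nondegenerateP (F : fieldType) (V : vectType F) (m : {symmetric V}) :
  nondegenerate m <-> (forall x, (forall y, m x y = 0) -> x = 0).
Proof.
rewrite /nondegenerate; split=> [/eqP m0 x mx|mx].
  by apply/eqP; rewrite -memv0 -m0; apply/mem_orthovP => y _.
rewrite -subv0; apply/subvP => x /mem_orthovP xm; rewrite memv0.
by apply/eqP/mx => y; apply: xm; rewrite memvf.
Qed.

Section Equivalence.
Context {R : realType} {g h : lieAlgType R}.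

Definition lie_isomorphism (xi : 'Hom(g, h)) : Prop :=
  bijective xi /\ forall x y, xi (lie x y) = lie (xi x) (xi y).

Definition lie_isomorphic : Prop := exists xi, lie_isomorphism xi.

Definition cps_equiv (J E : 'End(g)) (J' E' : 'End(h)) : Prop :=
  exists xi, [/\ lie_isomorphism xi,
    forall x, xi (J x) = J' (xi x) & forall x, xi (E x) = E' (xi x)].

(* The list [L] parametrizes the complex product structures underlying the
   hypersymplectic structures on [g]: all its members arise in this way, and
   every such structure on [g] is equivalent to exactly one of them.  As [L]
   is a set, coinciding members count once. *)
Definition parametrized_by (L : set ('End(h) * 'End(h))) : Prop :=
  (forall p, L p -> underlying_cps p.1 p.2) /\
  (forall J E : 'End(g), underlying_cps J E ->
    exists! p, L p /\ cps_equiv J E p.1 p.2).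

End Equivalence.

Arguments lie_isomorphic {R} g h.
Arguments parametrized_by {R} g h L.

Section Models.
Variable R : realType.

Definition v_ (k : nat) : 'cV[R]_4 := \col_i (i == k :> nat)%:R.

(* The skew-symmetric bilinear bracket with [v_ i, v_ j] = b i j for i < j. *)
Definition table_lie (b : nat -> nat -> 'cV[R]_4) (x y : 'cV[R]_4) : 'cV[R]_4 :=
  \sum_(i < 4) \sum_(j < 4 | (i < j)%N)
    (x i 0 * y j 0 - x j 0 * y i 0) *: b i j.

Lemma table_lie_linearl b y : linear ((table_lie b) ^~ y).
Proof.
move=> a u w; rewrite /table_lie scaler_sumr -big_split; apply: eq_bigr => i _.
rewrite scaler_sumr -big_split; apply: eq_bigr => j _ /=.
rewrite scalerA -scalerDl; congr (_ *: _); rewrite !mxE; ring.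
Qed.

Lemma table_lie_linearr b x : linear (table_lie b x).
Proof.
move=> a u w; rewrite /table_lie scaler_sumr -big_split; apply: eq_bigr => i _.
rewrite scaler_sumr -big_split; apply: eq_bigr => j _ /=.
rewrite scalerA -scalerDl; congr (_ *: _); rewrite !mxE; ring.
Qed.

Lemma table_liexx b x : table_lie b x x = 0.
Proof.
rewrite /table_lie big1 // => i _; rewrite big1 // => j _.
by rewrite mulrC subrr scale0r.
Qed.

Definition table_a (i j : nat) : 'cV[R]_4 := 0.

Definition table_gh0 (i j : nat) : 'cV[R]_4 :=
  match i, j with
  | 1%N, 2%N => v_ 3
  | _, _ => 0
  end.

Definition table_gh1 (i j : nat) : 'cV[R]_4 :=
  match i, j with
  | 0%N, 1%N => v_ 1
  | 0%N, 2%N => - v_ 2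
  | 0%N, 3%N => - v_ 3
  | _, _ => 0
  end.

Definition table_gh2 (i j : nat) : 'cV[R]_4 :=
  match i, j with
  | 0%N, 1%N => 2 *: v_ 1
  | 0%N, 2%N => - v_ 2
  | 0%N, 3%N => v_ 3
  | 1%N, 2%N => v_ 3
  | _, _ => 0
  end.

Let jacobi b := forall x y z,
  table_lie b x (table_lie b y z) + table_lie b y (table_lie b z x) +
  table_lie b z (table_lie b x y) = 0.

Lemma table_lieE b (x y : 'cV[R]_4) (m := fun i j : nat =>
    x (inord i) 0 * y (inord j) 0 - x (inord j) 0 * y (inord i) 0) :
  table_lie b x y =
    m 0%N 1%N *: b 0%N 1%N + m 0%N 2%N *: b 0%N 2%N + m 0%N 3%N *: b 0%N 3%N +
    m 1%N 2%N *: b 1%N 2%N + m 1%N 3%N *: b 1%N 3%N + m 2%N 3%N *: b 2%N 3%N.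
Proof.
have mE (i j : 'I_4) : x i 0 * y j 0 - x j 0 * y i 0 = m i j.
  by rewrite /m !inord_val.
rewrite /table_lie.
under eq_bigr do under eq_bigr do rewrite mE.
under eq_bigr do rewrite big_mkcond /=.
rewrite !big_ord_recl !big_ord0 /= /bump /=.
by rewrite !(add0r, addr0) !addrA.
Qed.

Lemma v_E (i j : nat) : (j < 4)%N -> v_ i (inord j) 0 = (j == i)%:R.
Proof. by move=> j4; rewrite mxE inordK. Qed.

Lemma coord4P (u w : 'cV[R]_4) :
  u (inord 0) 0 = w (inord 0) 0 -> u (inord 1) 0 = w (inord 1) 0 ->
  u (inord 2) 0 = w (inord 2) 0 -> u (inord 3) 0 = w (inord 3) 0 -> u = w.
Proof.
move=> e0 e1 e2 e3; apply/matrixP => i j; rewrite ord1 -[i]inord_val.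
by case: i => [[|[|[|[|//]]]]] i4 /=.
Qed.

Lemma table_lie_v (b : nat -> nat -> 'cV[R]_4) i j :
  (i < j < 4)%N -> table_lie b (v_ i) (v_ j) = b i j.
Proof.
case/andP=> ij j4; rewrite table_lieE !v_E //.
case: i j ij j4 => [|[|[|i]]] [|[|[|[|j]]]] //= _ _.
all: by rewrite !(mulr0n, mulr1n, mulr0, mul0r, mulr1, subr0, oppr0, scale0r,
  addr0, add0r, scale1r).
Qed.

Lemma table_a_jacobi : jacobi table_a.
Proof.
have a0 x y : table_lie table_a x y = 0.
  by rewrite table_lieE !scaler0 !addr0.
by move=> x y z; rewrite !a0 !addr0.
Qed.

Local Notation m x y i j :=
  (x (inord i) 0 * y (inord j) 0 - x (inord j) 0 * y (inord i) 0).

Lemma table_gh0E (x y : 'cV[R]_4) (z := table_lie table_gh0 x y) :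
  (z (inord 0) 0 = 0) *
  (z (inord 1) 0 = 0) *
  (z (inord 2) 0 = 0) *
  (z (inord 3) 0 = m x y 1 2).
Proof.
by rewrite /z table_lieE /= !mxE !inordK //=; do !split; ring.
Qed.

Lemma table_gh0_jacobi : jacobi table_gh0.
Proof.
move=> x y z.
by apply: coord4P; rewrite 2!mxE [RHS]mxE !table_gh0E; ring.
Qed.

Lemma table_gh1E (x y : 'cV[R]_4) (z := table_lie table_gh1 x y) :
  (z (inord 0) 0 = 0) *
  (z (inord 1) 0 = m x y 0 1) *
  (z (inord 2) 0 = - m x y 0 2) *
  (z (inord 3) 0 = - m x y 0 3).
Proof.
by rewrite /z table_lieE /= !mxE !inordK //=; do !split; ring.
Qed.

Lemma table_gh1_jacobi : jacobi table_gh1.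
Proof.
move=> x y z.
by apply: coord4P; rewrite 2!mxE [RHS]mxE !table_gh1E; ring.
Qed.

Lemma table_gh2E (x y : 'cV[R]_4) (z := table_lie table_gh2 x y) :
  (z (inord 0) 0 = 0) *
  (z (inord 1) 0 = 2 * m x y 0 1) *
  (z (inord 2) 0 = - m x y 0 2) *
  (z (inord 3) 0 = m x y 0 3 + m x y 1 2).
Proof.
by rewrite /z table_lieE /= !mxE !inordK //=; do !split; ring.
Qed.

Lemma table_gh2_jacobi : jacobi table_gh2.
Proof.
move=> x y z.
by apply: coord4P; rewrite 2!mxE [RHS]mxE !table_gh2E; ring.
Qed.

Definition abelian4 : Type := 'cV[R]_4.
Definition gh0 : Type := 'cV[R]_4.
Definition gh1 : Type := 'cV[R]_4.
Definition gh2 : Type := 'cV[R]_4.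

HB.instance Definition _ := Vector.copy abelian4 'cV[R]_4.
HB.instance Definition _ := isLieAlgebra.Build R abelian4
  (table_lie_linearl _) (table_lie_linearr _) (table_liexx _) table_a_jacobi.

HB.instance Definition _ := Vector.copy gh0 'cV[R]_4.
HB.instance Definition _ := isLieAlgebra.Build R gh0
  (table_lie_linearl _) (table_lie_linearr _) (table_liexx _) table_gh0_jacobi.

HB.instance Definition _ := Vector.copy gh1 'cV[R]_4.
HB.instance Definition _ := isLieAlgebra.Build R gh1
  (table_lie_linearl _) (table_lie_linearr _) (table_liexx _) table_gh1_jacobi.

HB.instance Definition _ := Vector.copy gh2 'cV[R]_4.
HB.instance Definition _ := isLieAlgebra.Build R gh2
  (table_lie_linearl _) (table_lie_linearr _) (table_liexx _) table_gh2_jacobi.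

End Models.

Section Matrices.
Context {R : realType}.

(* In the basis [X], the [j]-th column of [M] gives the image of [X`_j]. *)
Definition endo_of (V : vectType R) n (X : n.-tuple V) (M : 'M[R]_n) : 'End(V) :=
  linfun (fun v => \sum_i (\sum_j M i j * coord X j v) *: X`_i).

Lemma endo_ofE (V : vectType R) n (X : n.-tuple V) (M : 'M[R]_n) (j : 'I_n) :
  basis_of fullv X -> endo_of X M X`_j = \sum_i M i j *: X`_i.
Proof.
move=> /basis_free Xfree; pose f v := \sum_i (\sum_j M i j * coord X j v) *: X`_i.
have flin : linear f.
  move=> a u w; rewrite /f scaler_sumr -big_split; apply: eq_bigr => i _ /=.
  rewrite scalerA -scalerDl mulr_sumr -big_split; congr (_ *: _).
  by apply: eq_bigr => k _ /=; rewrite linearP /= mulrDr mulrCA.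
pose f' : {linear V -> V} := HB.pack f (GRing.isLinear.Build _ _ _ _ f flin).
rewrite /endo_of -/f (lfunE f') /= /f; apply: eq_bigr => i _.
rewrite (bigD1 j) //= coord_free // eqxx mulr1 big1 ?addr0 // => k kj.
by rewrite coord_free // eq_sym (negbTE kj) mulr0.
Qed.

Definition mx4 (rows : seq (seq R)) : 'M[R]_4 :=
  \matrix_(i, j) nth 0 (nth [::] rows i) j.

Definition Jflat : 'M[R]_4 := block_mx (0 : 'M_2) (- 1%:M) 1%:M (0 : 'M_2).
Definition Eflat : 'M[R]_4 := block_mx (1%:M : 'M_2) 0 0 (- 1%:M : 'M_2).

Definition J0 : 'M[R]_4 := mx4
  [:: [:: 0; -1; 0;  0];
      [:: 1;  0; 0;  0];
      [:: 0;  0; 0; -1];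
      [:: 0;  0; 1;  0]].

Definition E0 (t : R) : 'M[R]_4 := mx4
  [:: [:: 1;  0;     0;       0];
      [:: 0; -1;     0;       0];
      [:: 0;  0; cos t;   sin t];
      [:: 0;  0; sin t; - cos t]].

Definition J1 : 'M[R]_4 := mx4
  [:: [:: 0; -1; 0;  0];
      [:: 1;  0; 0;  0];
      [:: 0;  0; 0; -1];
      [:: 0;  0; 1;  0]].

Definition E1 (t d : R) : 'M[R]_4 := mx4
  [:: [:: cos t;           sin t;           0;  0];
      [:: sin t;           - cos t;         0;  0];
      [:: - d * sin t;     d * (1 + cos t); 1;  0];
      [:: d * (1 + cos t); d * sin t;       0; -1]].

Definition E1_exc : 'M[R]_4 := mx4
  [:: [:: -1; 0; 0;  0];
      [::  0; 1; 0;  0];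
      [:: -2; 0; 1;  0];
      [::  0; 2; 0; -1]].

Definition J2 : 'M[R]_4 := mx4
  [:: [::  0; 1; 0;  0];
      [:: -1; 0; 0;  0];
      [::  0; 0; 0; -1];
      [::  0; 0; 1;  0]].

Definition E2 (t d : R) : 'M[R]_4 := mx4
  [:: [:: cos t; sin t; 0; 0];
      [:: sin t; - cos t; 0; 0];
      [:: d * sin t * (1 + cos t); - d * cos t * (1 + cos t); cos t; - sin t];
      [:: d * cos t * (1 + cos t); d * sin t * (1 + cos t); - sin t; - cos t]].

Definition E2_exc : 'M[R]_4 := mx4
  [:: [:: -1; 0;  0; 0];
      [::  0; 1;  0; 0];
      [::  0; 2; -1; 0];
      [:: -2; 0;  0; 1]].

End Matrices.

Section Lists.
Variable R : realType.

Definition basis_gh0 : 4.-tuple (gh0 R) := [tuple v_ R 1; v_ R 2; v_ R 3; v_ R 0].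
Definition basis_gh1 : 4.-tuple (gh1 R) := [tuple v_ R 0; v_ R 1; v_ R 2; v_ R 3].
Definition basis_gh2 : 4.-tuple (gh2 R) := [tuple v_ R 0; v_ R 2; v_ R 1; v_ R 3].

Lemma v_basis (s : 'I_4 -> 'I_4) (X : 4.-tuple 'cV[R]_4) :
  injective s -> (forall i : 'I_4, X`_i = v_ R (s i)) -> basis_of fullv X.
Proof.
have d4 : \dim {: 'cV[R]_4} = 4%N by rewrite dimvf.
move=> sI XE; rewrite basisEfree subvf size_tuple d4 andbT /=.
apply/freeP => k k0 i; move/matrixP/(_ (s i) 0): k0.
rewrite summxE mxE (bigD1 i) //= XE !mxE eqxx mulr1 big1 ?addr0 // => j ji.
by rewrite XE !mxE (inj_eq val_inj) (inj_eq sI) eq_sym (negbTE ji) mulr0.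
Qed.

Lemma basis_gh0P : basis_of fullv basis_gh0.
Proof.
apply: (@v_basis (fun i => inord (nth 0 [:: 1; 2; 3; 0]%N i))).
  by move=> [[|[|[|[|//]]]]] i4 [[|[|[|[|//]]]]] j4 /(congr1 val);
    rewrite /= !inordK //= => // _; apply: val_inj.
by case=> [[|[|[|[|//]]]]] i4 /=; rewrite !inordK.
Qed.

Lemma basis_gh1P : basis_of fullv basis_gh1.
Proof.
apply: (@v_basis id) => //.
by case=> [[|[|[|[|//]]]]] i4 /=.
Qed.

Lemma basis_gh2P : basis_of fullv basis_gh2.
Proof.
apply: (@v_basis (fun i => inord (nth 0 [:: 0; 2; 1; 3]%N i))).
  by move=> [[|[|[|[|//]]]]] i4 [[|[|[|[|//]]]]] j4 /(congr1 val);
    rewrite /= !inordK //= => // _; apply: val_inj.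
by case=> [[|[|[|[|//]]]]] i4 /=; rewrite !inordK.
Qed.

Definition cps_flat (X : 4.-tuple (abelian4 R)) :
    set ('End(abelian4 R) * 'End(abelian4 R)) :=
  [set (endo_of X Jflat, endo_of X Eflat)].

Definition cps_gh0 : set ('End(gh0 R) * 'End(gh0 R)) :=
  [set (endo_of basis_gh0 J0, endo_of basis_gh0 (E0 t)) | t in `[0, 2 * pi[].

Definition cps_gh1 : set ('End(gh1 R) * 'End(gh1 R)) :=
  [set (endo_of basis_gh1 J1, endo_of basis_gh1 (E1 t d))
     | t in `[0, 2 * pi[ & d in [set 0; 1]]
  `|` [set (endo_of basis_gh1 J1, endo_of basis_gh1 E1_exc)].

Definition cps_gh2 : set ('End(gh2 R) * 'End(gh2 R)) :=
  [set (endo_of basis_gh2 J2, endo_of basis_gh2 (E2 t d))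
     | t in `[0, 2 * pi[ & d in [set 0; 1]]
  `|` [set (endo_of basis_gh2 J2, endo_of basis_gh2 E2_exc)].

End Lists.

Arguments cps_gh0 R : clear implicits.
Arguments cps_gh1 R : clear implicits.
Arguments cps_gh2 R : clear implicits.

(* Main.v *)
From HB Require Import structures.
Require Import Defs.
From mathcomp Require Import all_boot all_order all_algebra.
From mathcomp Require Import ring lra.
From mathcomp Require Import boolp classical_sets set_interval reals trigo.

(** The classification is a problem about two linear maps on a plane.

    A complex product structure splits the algebra as V + J V, where V is the
    +1 eigenspace of E, a plane.  Define A, B : V -> gl(V) by
    [v, J w] = J (A(v) w) - B(w) v.  Integrability of E and J then forces
    [v, w] = A(v) w - A(w) v and [J v, J w] = J (B(v) w - B(w) v), so A and B
    determine the algebra.  A compatible metric is unique up to scale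
    ([compatible_formE]), and the closedness of its three forms says that all
    the A(v) and B(v) have trace zero ([brackets_exist]).  Conversely, an
    algebra with such brackets is hypersymplectic ([brackets_underlying]).

    The Jacobi identity contains the flatness of A, of B and its polarization:
    A + s B is, for every s, a flat torsion-free trace-free connection on V
    ([brackets_jacobi]).  In dimension two such a connection, if nonzero,
    distinguishes a line in V, and A and B have a common one.  Taking the second
    basis vector e2 in this line leaves, for each of A and B, three numbers:
    A(e1) e1 = - ma e1 + ca e2, A(e1) e2 = ma e2, A(e2) e1 = ka e2,
    A(e2) e2 = 0, and likewise mb, kb, cb for B; moreover k = (ka, kb) is
    either 0 or - m ([normal_form_exists]).

    The remaining changes of basis multiply m by a nonzero number, and multiply
    c by another one after adding to it a multiple of m
    ([normal_form_change]).  So the invariants are the value of k, the line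
    spanned by m (or by c when m = 0), and whether c is proportional to m
    ([normal_form_equiv]).  The case m = c = 0 is abelian, m = 0 <> c is gh0,
    m <> 0 = k is gh1 and k = - m <> 0 is gh2.  In the list of models, the line
    is the one spanned by a vector with coordinates +- cos (t / 2) and
    +- sin (t / 2) in some order, and d = 0, d = 1 distinguish c proportional
    to m or not.  At t = pi the matrices for d = 0 and d = 1 coincide, and the
    exceptional structure takes the place of the missing one.

    The members of a list are pairwise inequivalent because an automorphism
    rescales the functional that vanishes on the derived algebra of gh1 or gh2,
    and the vector that spans the derived algebra of gh0, in terms of which
    cos t and sin t can be read off ([angle_rigid], [gh0_rigid]), and because it
    preserves the vanishing of a vector that detects d ([defect_rigid]).
    Finally, the four Lie algebras satisfy different commutator laws. *)

Set Implicit Arguments.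
Unset Strict Implicit.
Unset Printing Implicit Defensive.

Import Order.TTheory GRing.Theory Num.Theory.

Local Open Scope ring_scope.

(** * Identities in modules, brackets and frames *)

(** Linear functionals separate points.  This turns an equality of linear
    combinations into a scalar identity, which [ring] can decide. *)
Lemma vect_ext (R : fieldType) (V : vectType R) (x y : V) :
  (forall f : V -> R, {morph f : u w / u + w} ->
    (forall a u, f (a *: u) = a * f u) -> {morph f : u / - u} ->
    f 0 = 0 -> f x = f y) ->
  x = y.
Proof.
move=> fxy; rewrite (coord_vbasis (memvf x)) (coord_vbasis (memvf y)).
apply: eq_bigr => i _; congr (_ *: _); apply: fxy => [u w|a u|u|].
- exact: linearD.
- exact: linearZ.
- exact: linearN.
- exact: linear0.
Qed.

Ltac module :=
  let f := fresh "f" in let fD := fresh "fD" in let fZ := fresh "fZ" in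
  let fN := fresh "fN" in let f0 := fresh "f0" in
  apply: vect_ext; intros f fD fZ fN f0; rewrite ?(fD, fZ, fN, f0); ring.

Section Bracket.
Context {R : realType} {g : lieAlgType R}.
Implicit Types (x y z : g) (a : R).

Lemma lieDl y : {morph (fun x => lie x y) : u w / u + w}.
Proof. by move=> u w; have := lie_linearl y 1 u w; rewrite !scale1r. Qed.

Lemma lieDr x : {morph lie x : u w / u + w}.
Proof. by move=> u w; have := lie_linearr x 1 u w; rewrite !scale1r. Qed.

Lemma lie0l y : lie 0 y = 0.
Proof. by apply: (addrI (lie 0 y)); rewrite -lieDl !addr0. Qed.

Lemma lie0r x : lie x 0 = 0.
Proof. by apply: (addrI (lie x 0)); rewrite -lieDr !addr0. Qed.

Lemma lieZl a x y : lie (a *: x) y = a *: lie x y.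
Proof. by have := lie_linearl y a x 0; rewrite lie0l !addr0. Qed.

Lemma lieZr a x y : lie x (a *: y) = a *: lie x y.
Proof. by have := lie_linearr x a y 0; rewrite lie0r !addr0. Qed.

Lemma lieNl x y : lie (- x) y = - lie x y.
Proof. by rewrite -scaleN1r lieZl scaleN1r. Qed.

Lemma lieNr x y : lie x (- y) = - lie x y.
Proof. by rewrite -scaleN1r lieZr scaleN1r. Qed.

Lemma lieC x y : lie y x = - lie x y.
Proof.
apply/eqP; rewrite -addr_eq0; apply/eqP.
by have := liexx (x + y); rewrite lieDl !lieDr !liexx add0r addr0 addrC.
Qed.

Definition lieE := (lieDl, lieDr, lieZl, lieZr, lieNl, lieNr, lie0l, lie0r).

End Bracket.

Section Form.
Context {R : realType} {g : lieAlgType R} (m : {symmetric g}).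

Lemma sformDl z : {morph (fun x => m x z) : u w / u + w}.
Proof. by move=> u w; rewrite linearDl. Qed.
Lemma sformZl a x z : m (a *: x) z = a * m x z.
Proof. by rewrite linearZl_LR. Qed.
Lemma sformNl x z : m (- x) z = - m x z.
Proof. by rewrite linearNl. Qed.
Lemma sform0l z : m 0 z = 0.
Proof. by rewrite linear0l. Qed.
Lemma sformC x y : m x y = m y x.
Proof. by rewrite hermitian_subproof expr0 mul1r. Qed.
Lemma sformDr z : {morph m z : u w / u + w}.
Proof. by move=> u w; rewrite linearDr. Qed.
Lemma sformZr a x z : m z (a *: x) = a * m z x.
Proof. by rewrite linearZr_LR. Qed.
Lemma sformNr x z : m z (- x) = - m z x.
Proof. by rewrite linearNr. Qed.
Lemma sform0r z : m z 0 = 0.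
Proof. by rewrite linear0r. Qed.

Definition sformE :=
  (sformDl, sformZl, sformNl, sform0l, sformDr, sformZr, sformNr, sform0r).
End Form.

Lemma endD {R : realType} {g : lieAlgType R} (F : 'End(g)) :
  {morph F : u w / u + w}.
Proof. exact: linearD. Qed.
Lemma endZ {R : realType} {g : lieAlgType R} (F : 'End(g)) a u :
  F (a *: u) = a *: F u.
Proof. exact: linearZ. Qed.
Lemma endN {R : realType} {g : lieAlgType R} (F : 'End(g)) :
  {morph F : u / - u}.
Proof. exact: linearN. Qed.
Lemma end0 {R : realType} {g : lieAlgType R} (F : 'End(g)) : F 0 = 0.
Proof. exact: linear0. Qed.
Definition endE := (@endD, @endZ, @endN, @end0).

Section Frame.
Context {R : fieldType} {V : vectType R}.
Implicit Types (x y : V) (a b c d : R).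

Definition lc y0 y1 y2 y3 a b c d := a *: y0 + b *: y1 + c *: y2 + d *: y3.

Definition frame y0 y1 y2 y3 := basis_of fullv [tuple y0; y1; y2; y3].

Lemma lc_sum y0 y1 y2 y3 (k : 'I_4 -> R) :
  \sum_(i < 4) k i *: [tuple y0; y1; y2; y3]`_i =
  lc y0 y1 y2 y3 (k (@Ordinal 4 0 isT)) (k (@Ordinal 4 1 isT))
    (k (@Ordinal 4 2 isT)) (k (@Ordinal 4 3 isT)).
Proof.
rewrite !big_ord_recl big_ord0 addr0 !addrA /lc /=.
by do !congr (_ + _); congr (k _ *: _); apply: val_inj.
Qed.

Lemma frameP y0 y1 y2 y3 : \dim {: V} = 4%N ->
  (forall a b c d, lc y0 y1 y2 y3 a b c d = 0 ->
     [/\ a = 0, b = 0, c = 0 & d = 0]) ->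
  frame y0 y1 y2 y3.
Proof.
move=> dimV lc0; rewrite /frame basisEfree subvf dimV /= andbT.
apply/freeP => k; rewrite lc_sum => /lc0[k0 k1 k2 k3].
by case=> [[|[|[|[|//]]]]] i4; [rewrite -k0|rewrite -k1|rewrite -k2|rewrite -k3];
  congr (k _); apply: val_inj.
Qed.

Variables (y0 y1 y2 y3 : V).
Hypothesis yB : frame y0 y1 y2 y3.

(** The coordinate is 0 for an index out of range, so that the index can be a
    plain natural number. *)
Definition co k x : R :=
  if insub k is Some i then coord [tuple y0; y1; y2; y3] i x else 0.

Lemma coD k : {morph co k : u w / u + w}.
Proof. by move=> u w; rewrite /co; case: insub => [i|]; rewrite ?addr0 ?linearD. Qed.

Lemma coZ k a u : co k (a *: u) = a * co k u.
Proof. by rewrite /co; case: insub => [i|]; rewrite ?mulr0 ?linearZ. Qed.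

Lemma coN k : {morph co k : u / - u}.
Proof. by move=> u; rewrite -scaleN1r coZ mulN1r. Qed.

Lemma co0 k : co k 0 = 0.
Proof. by rewrite -(scale0r (0 : V)) coZ mul0r. Qed.

Lemma co_frame (i j : nat) : (j < 4)%N ->
  co i [tuple y0; y1; y2; y3]`_j = (i == j)%:R.
Proof.
move=> j4; rewrite /co; case: insubP => [k _ <-|].
  have -> : [tuple y0; y1; y2; y3]`_j = [tuple y0; y1; y2; y3]`_(Ordinal j4) by [].
  by rewrite coord_free ?(basis_free yB) // eq_sym.
by case: eqP => // ->; rewrite j4.
Qed.

Lemma coE0 i : co i y0 = (i == 0)%:R. Proof. exact: (@co_frame i 0). Qed.
Lemma coE1 i : co i y1 = (i == 1)%:R. Proof. exact: (@co_frame i 1). Qed.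
Lemma coE2 i : co i y2 = (i == 2)%:R. Proof. exact: (@co_frame i 2). Qed.
Lemma coE3 i : co i y3 = (i == 3)%:R. Proof. exact: (@co_frame i 3). Qed.

Lemma frameE x : x = lc y0 y1 y2 y3 (co 0 x) (co 1 x) (co 2 x) (co 3 x).
Proof.
by rewrite {1}(coord_basis yB (memvf x)) (lc_sum _ _ _ _ (fun i => coord _ i x));
  rewrite /co !insubT.
Qed.

Lemma co_inj x y : co 0 x = co 0 y -> co 1 x = co 1 y -> co 2 x = co 2 y ->
  co 3 x = co 3 y -> x = y.
Proof. by move=> e0 e1 e2 e3; rewrite (frameE x) (frameE y) e0 e1 e2 e3. Qed.

Lemma co_lc a b c d : let x := lc y0 y1 y2 y3 a b c d in
  (co 0 x = a) * (co 1 x = b) * (co 2 x = c) * (co 3 x = d).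
Proof.
rewrite /lc; do !split; rewrite !(coD, coZ) coE0 coE1 coE2 coE3 /=;
by rewrite ?mulr0n ?mulr1n !(mulr1, mulr0, addr0, add0r).
Qed.

Lemma lc_inj a b c d a' b' c' d' :
  lc y0 y1 y2 y3 a b c d = lc y0 y1 y2 y3 a' b' c' d' ->
  [/\ a = a', b = b', c = c' & d = d'].
Proof.
by move=> e; split; [have := congr1 (co 0) e|have := congr1 (co 1) e|
  have := congr1 (co 2) e|have := congr1 (co 3) e]; rewrite !co_lc.
Qed.

End Frame.

Section FrameLie.
Context {R : realType} {g : lieAlgType R}.

Lemma lie_lc (y0 y1 y2 y3 : g) a b c d a' b' c' d' :
  lie (lc y0 y1 y2 y3 a b c d) (lc y0 y1 y2 y3 a' b' c' d') =
  (a * b' - b * a') *: lie y0 y1 + (a * c' - c * a') *: lie y0 y2 +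
  (a * d' - d * a') *: lie y0 y3 + (b * c' - c * b') *: lie y1 y2 +
  (b * d' - d * b') *: lie y1 y3 + (c * d' - d * c') *: lie y2 y3.
Proof.
rewrite /lc !lieE !liexx (lieC y0 y1) (lieC y0 y2) (lieC y0 y3) (lieC y1 y2).
rewrite (lieC y1 y3) (lieC y2 y3); module.
Qed.

Lemma end_lc (F : 'End(g)) (y0 y1 y2 y3 : g) a b c d :
  F (lc y0 y1 y2 y3 a b c d) = lc (F y0) (F y1) (F y2) (F y3) a b c d.
Proof. by rewrite /lc !endE. Qed.

End FrameLie.

Section Iso.
Context {R : realType}.

Lemma lie_iso_inv (g h : lieAlgType R) (xi : 'Hom(g, h)) : lie_isomorphism xi ->
  exists zeta : 'Hom(h, g),
    [/\ lie_isomorphism zeta, cancel xi zeta & cancel zeta xi].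
Proof.
case=> -[f xiK fK] xiL.
have flin : linear f.
  move=> a u w; apply: (can_inj xiK); rewrite fK linearP /=.
  by rewrite !fK.
pose f' : {linear h -> g} := HB.pack f (GRing.isLinear.Build _ _ _ _ f flin).
have fE x : linfun f' x = f x by rewrite lfunE.
exists (linfun f'); split=> [|x|x]; rewrite ?fE //.
split; first by exists xi => x; rewrite fE.
by move=> x y; apply: (can_inj xiK); rewrite !fE fK xiL !fK.
Qed.

Lemma lie_iso_comp (g h k : lieAlgType R) (xi : 'Hom(g, h)) (eta : 'Hom(h, k)) :
  lie_isomorphism xi -> lie_isomorphism eta ->
  lie_isomorphism (eta \o xi)%VF.
Proof.
move=> [xiB xiL] [etaB etaL]; split.
  apply: (eq_bij (bij_comp etaB xiB)) => x; by rewrite comp_lfunE.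
by move=> x y; rewrite !comp_lfunE xiL etaL.
Qed.

Lemma cps_equiv_refl (g : lieAlgType R) (J E : 'End(g)) : cps_equiv J E J E.
Proof.
exists \1%VF; split=> [|x|x]; rewrite ?id_lfunE //; split=> [|x y].
  by exists \1%VF => x; rewrite !id_lfunE.
by rewrite !id_lfunE.
Qed.

Lemma cps_equiv_common (g h k : lieAlgType R) (J E : 'End(g)) (J' E' : 'End(h))
    (J'' E'' : 'End(k)) :
  cps_equiv J E J' E' -> cps_equiv J E J'' E'' -> cps_equiv J' E' J'' E''.
Proof.
move=> [xi [xiI xiJ xiE]] [eta [etaI etaJ etaE]].
have [zeta [zetaI xiK zetaK]] := lie_iso_inv xiI.
exists (eta \o zeta)%VF; split; first exact: lie_iso_comp.
- move=> x; rewrite !comp_lfunE -etaJ; congr (eta _).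
  by apply: (can_inj xiK); rewrite zetaK xiJ zetaK.
- move=> x; rewrite !comp_lfunE -etaE; congr (eta _).
  by apply: (can_inj xiK); rewrite zetaK xiE zetaK.
Qed.

(** The map that matches two frames is bijective; only its compatibility with
    the brackets and the endomorphisms has to be checked, on combinations. *)
Lemma frame_cps_equiv (g h : lieAlgType R) (J E : 'End(g)) (J' E' : 'End(h))
    (y0 y1 y2 y3 : g) (z0 z1 z2 z3 : h) :
  frame y0 y1 y2 y3 -> frame z0 z1 z2 z3 ->
  (forall xi : 'Hom(g, h),
     (forall x, exists a b c d, x = lc y0 y1 y2 y3 a b c d) ->
     (forall a b c d, xi (lc y0 y1 y2 y3 a b c d) = lc z0 z1 z2 z3 a b c d) ->
     [/\ forall x y, xi (lie x y) = lie (xi x) (xi y),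
         forall x, xi (J x) = J' (xi x) & forall x, xi (E x) = E' (xi x)]) ->
  cps_equiv J E J' E'.
Proof.
move=> yB zB H.
pose f (x : g) := lc z0 z1 z2 z3 (co y0 y1 y2 y3 0 x) (co y0 y1 y2 y3 1 x)
  (co y0 y1 y2 y3 2 x) (co y0 y1 y2 y3 3 x).
have flin : linear f.
  by move=> a u w; rewrite /f !(coD, coZ) /lc; module.
pose f' : {linear g -> h} := HB.pack f (GRing.isLinear.Build _ _ _ _ f flin).
have fE x : linfun f' x = f x by rewrite lfunE.
have [|a b c d|L HJ HE] := H (linfun f').
- by move=> x; do 4 eexists; exact: (frameE yB).
- by rewrite fE /f !(co_lc yB).
exists (linfun f'); split=> //; split=> //.
exists (fun x => lc y0 y1 y2 y3 (co z0 z1 z2 z3 0 x) (co z0 z1 z2 z3 1 x)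
  (co z0 z1 z2 z3 2 x) (co z0 z1 z2 z3 3 x)) => x.
  by rewrite fE /f !(co_lc zB) -(frameE yB).
by rewrite fE /f !(co_lc yB) -(frameE zB).
Qed.

End Iso.

(** * Frames adapted to a complex product structure *)

Section Adapted.
Context {R : realType} {g : lieAlgType R}.
Implicit Types (J E : 'End(g)) (v w : g).

Record adapted J E v1 v2 : Prop := Adapted {
  adapted_frame : frame v1 v2 (J v1) (J v2);
  adapted_E1 : E v1 = v1;
  adapted_E2 : E v2 = v2;
  adapted_J1 : J (J v1) = - v1;
  adapted_J2 : J (J v2) = - v2;
  adapted_EJ1 : E (J v1) = - J v1;
  adapted_EJ2 : E (J v2) = - J v2
}.

Lemma eq_opp_0 (x : g) : x = - x -> x = 0.
Proof.
move/eqP; rewrite -subr_eq0 opprK -mulr2n -scaler_nat scaler_eq0 pnatr_eq0 /=.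
by move/eqP.
Qed.

Lemma adapted_intro J E v1 v2 : \dim {: g} = 4%N ->
  (forall a b, a *: v1 + b *: v2 = 0 -> a = 0 /\ b = 0) ->
  E v1 = v1 -> E v2 = v2 -> J (J v1) = - v1 -> J (J v2) = - v2 ->
  E (J v1) = - J v1 -> E (J v2) = - J v2 -> adapted J E v1 v2.
Proof.
move=> dimg v_free E1 E2 J1 J2 EJ1 EJ2; split=> //.
apply: frameP => // a b c d abcd0.
have := congr1 E abcd0; rewrite end_lc E1 E2 EJ1 EJ2 end0 => abcd0'.
have /eq_opp_0 ab0 : a *: v1 + b *: v2 = - (a *: v1 + b *: v2).
  rewrite -[LHS]subr0 -abcd0 -[RHS]addr0 -abcd0' /lc; module.
have [a0 b0] := v_free _ _ ab0.
have := congr1 J abcd0; rewrite end_lc a0 b0 J1 J2 end0 /lc => cd0.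
have [|c0 d0] := v_free (- c) (- d).
  by rewrite -cd0; module.
by split=> //; apply: oppr_inj; rewrite ?c0 ?d0 oppr0.
Qed.

Variables (J E : 'End(g)).
Hypotheses (dimg : \dim {: g} = 4%N) (cpsJE : complex_product_structure J E).

Let JJ x : J (J x) = - x. Proof. by case: cpsJE => -[]. Qed.
Let EE x : E (E x) = x. Proof. by case: cpsJE => _ []. Qed.
Let JE x : J (E x) = - E (J x). Proof. by case: cpsJE. Qed.

Lemma adapted_pair v1 v2 :
  (forall a b, a *: v1 + b *: v2 = 0 -> a = 0 /\ b = 0) ->
  E v1 = v1 -> E v2 = v2 -> adapted J E v1 v2.
Proof.
move=> v_free E1 E2; apply: adapted_intro; rewrite ?JJ //.
- by rewrite -{2}E1 JE opprK.
- by rewrite -{2}E2 JE opprK.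
Qed.

(** J exchanges the two eigenspaces of E, so both are planes; a basis of the
    +1 eigenspace gives the frame. *)
Lemma adapted_exists : exists v1 v2, adapted J E v1 v2.
Proof.
(* dim U = dim W because J maps each of them into the other. *)
pose U := lker (E - \1%VF); pose W := lker (E + \1%VF).
have memU x : (x \in U) = (E x == x).
  by rewrite memv_ker add_lfunE opp_lfunE id_lfunE subr_eq0.
have memW x : (x \in W) = (E x == - x).
  by rewrite memv_ker add_lfunE id_lfunE addr_eq0.
have JI : lker J = 0%VS.
  apply/eqP; rewrite -subv0; apply/subvP => x; rewrite memv_ker memv0 => /eqP Jx.
  by rewrite -oppr_eq0 -JJ Jx end0.
have dimJ (X : {vspace g}) : \dim (J @: X) = \dim X.
  by rewrite limg_dim_eq // JI capv0.
have UW : (J @: U <= W)%VS.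
  apply/subvP => _ /memv_imgP[x xU ->]; rewrite memU in xU.
  by rewrite memW -{2}(eqP xU) JE opprK.
have WU : (J @: W <= U)%VS.
  apply/subvP => _ /memv_imgP[x xW ->]; rewrite memW in xW.
  by rewrite memU -[E _]opprK -JE (eqP xW) endN opprK.
have dimUW : \dim U = \dim W.
  by apply/eqP; rewrite eqn_leq -{1}(dimJ U) -{2}(dimJ W) !dimvS.
have UW0 : (U :&: W = 0)%VS.
  apply/eqP; rewrite -subv0; apply/subvP => x.
  rewrite memv_cap memU memW memv0 => /andP[/eqP Ex].
  by rewrite Ex => /eqP/eq_opp_0->.
have UWT : (U + W = fullv)%VS.
  apply/eqP; rewrite eqEsubv subvf /=; apply/subvP => x _.
  have -> : x = 2^-1 *: (x + E x) + 2^-1 *: (x - E x).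
    rewrite -scalerDr; have -> : x + E x + (x - E x) = 2 *: x by module.
    by rewrite scalerA mulVf ?scale1r // pnatr_eq0.
  apply: memv_add; apply: memvZ.
    by rewrite memU endD EE addrC.
  by rewrite memW endD endN EE opprB addrC.
have dimU : \dim U = 2%N.
  have := dimv_disjoint_sum UW0; rewrite UWT dimg -dimUW addnn => /esym/eqP.
  by rewrite -[4%N]/(2.*2) (inj_eq double_inj) => /eqP.
have [[X sX] /= XB] : exists X : 2.-tuple g, basis_of U X.
  by rewrite -dimU; exists (vbasis U); exact: vbasisP.
case: X sX XB => [|v1 [|v2 [|]]] // sX XB; exists v1, v2.
have /eqP E1 : E v1 == v1.
  by rewrite -memU (basis_mem XB) // inE eqxx.
have /eqP E2 : E v2 == v2.
  by rewrite -memU (basis_mem XB) // !inE eqxx orbT.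
apply: adapted_pair => // a b ab0.
have /freeP Xfree := basis_free XB.
have := Xfree (fun i => if val i == 0%N then a else b).
rewrite !big_ord_recl big_ord0 addr0 /= => /(_ ab0) k0.
by split; [exact: (k0 ord0)|exact: (k0 (lift ord0 ord0))].
Qed.

End Adapted.

Lemma adapted_pair_free (R : realType) (g : lieAlgType R) (J E : 'End(g)) v1 v2 :
  adapted J E v1 v2 -> forall a b, a *: v1 + b *: v2 = 0 -> a = 0 /\ b = 0.
Proof.
move=> ad a b ab0.
have : lc v1 v2 (J v1) (J v2) a b 0 0 = lc v1 v2 (J v1) (J v2) 0 0 0 0.
  by rewrite /lc !scale0r !addr0.
by case/(lc_inj (adapted_frame ad)).
Qed.

(** * Structure constants of a hypersymplectic algebra *)

Section AdaptedCoordinates.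
Context {R : realType} {g : lieAlgType R} (J E : 'End(g)) (e1 e2 : g).
Hypothesis ad : adapted J E e1 e2.

Local Notation f1 := (J e1).
Local Notation f2 := (J e2).
Local Notation co := (co e1 e2 f1 f2).
Let fr := adapted_frame ad.

Lemma adapted_coJ x : (co 0 (J x) = - co 2 x) * (co 1 (J x) = - co 3 x) *
  (co 2 (J x) = co 0 x) * (co 3 (J x) = co 1 x).
Proof.
have -> : J x = lc e1 e2 f1 f2 (- co 2 x) (- co 3 x) (co 0 x) (co 1 x).
  rewrite {1}(frameE fr x) end_lc (adapted_J1 ad) (adapted_J2 ad) /lc; module.
by rewrite !(co_lc fr).
Qed.

Lemma adapted_coE x : (co 0 (E x) = co 0 x) * (co 1 (E x) = co 1 x) *
  (co 2 (E x) = - co 2 x) * (co 3 (E x) = - co 3 x).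
Proof.
have -> : E x = lc e1 e2 f1 f2 (co 0 x) (co 1 x) (- co 2 x) (- co 3 x).
  rewrite {1}(frameE fr x) end_lc (adapted_E1 ad) (adapted_E2 ad).
  rewrite (adapted_EJ1 ad) (adapted_EJ2 ad) /lc; module.
by rewrite !(co_lc fr).
Qed.

Definition coordE :=
  (coE0 fr, coE1 fr, coE2 fr, coE3 fr, adapted_coJ, adapted_coE).

(** Both eigenspaces of E are isotropic, and J makes the pairing between them
    skew, so one number is left. *)
Lemma compatible_formE (m : {symmetric g}) : compatible J E m ->
  forall x y, m x y =
    m e1 f2 * (co 0 x * co 3 y + co 3 x * co 0 y - co 1 x * co 2 y
               - co 2 x * co 1 y).
Proof.
move=> [mJ mE].
have E1 := adapted_E1 ad; have E2 := adapted_E2 ad.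
have EJ1 := adapted_EJ1 ad; have EJ2 := adapted_EJ2 ad.
have J1 := adapted_J1 ad; have J2 := adapted_J2 ad.
have h11 : m e1 e1 = 0 by have := mE e1 e1; rewrite E1; lra.
have h12 : m e1 e2 = 0 by have := mE e1 e2; rewrite E1 E2; lra.
have h22 : m e2 e2 = 0 by have := mE e2 e2; rewrite E2; lra.
have k11 : m f1 f1 = 0 by rewrite mJ.
have k12 : m f1 f2 = 0 by rewrite mJ.
have k22 : m f2 f2 = 0 by rewrite mJ.
have l11 : m e1 f1 = 0.
  by have := mJ e1 f1; rewrite J1 !sformE (sformC _ f1); lra.
have l22 : m e2 f2 = 0.
  by have := mJ e2 f2; rewrite J2 !sformE (sformC _ f2); lra.
have l21 : m e2 f1 = - m e1 f2.
  by have := mJ e2 f1; rewrite J1 !sformE (sformC _ f2); lra.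
move=> x y; rewrite {1}(frameE fr x) {1}(frameE fr y) /lc !sformE.
rewrite (sformC m e2 e1) (sformC m f1 e1) (sformC m f1 e2) (sformC m f2 e1).
rewrite (sformC m f2 e2) (sformC m f2 f1) h11 h12 h22 k11 k12 k22 l11 l22 l21.
ring.
Qed.

(** With A(e1) = [p, q; r, - p] and A(e2) = [p', q'; r', - p'] in the basis
    e1, e2, and B given in the same way by the capitals, these are the brackets
    [v, J w] = J (A(v) w) - B(w) v and those they determine. *)
Record brackets (p q r p' q' r' P Q S P' Q' S' : R) : Prop := Brackets {
  br_ee : lie e1 e2 = (q - p') *: e1 - (p + r') *: e2;
  br_ff : lie f1 f2 = (Q - P') *: f1 - (P + S') *: f2;
  br_11 : lie e1 f1 = p *: f1 + r *: f2 - P *: e1 - S *: e2;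
  br_12 : lie e1 f2 = q *: f1 - p *: f2 - P' *: e1 - S' *: e2;
  br_21 : lie e2 f1 = p' *: f1 + r' *: f2 - Q *: e1 + P *: e2;
  br_22 : lie e2 f2 = q' *: f1 - p' *: f2 - Q' *: e1 + P' *: e2
}.

(** Closedness of the forms of J and J E on (f1, f2, e_i) and (e1, e2, f_i)
    gives the vanishing of the traces of A(e_i) and B(e_i); integrability of E
    makes the eigenspaces subalgebras; integrability of J on (e1, e2) expresses
    [e1, e2] and [f1, f2] by A and B. *)
Lemma brackets_exist : underlying_cps J E ->
  exists p q r p' q' r' P Q S P' Q' S', brackets p q r p' q' r' P Q S P' Q' S'.
Proof.
case=> m [[[_ Jint] [_ _ _ Eint] _] [mnd mc] w1 w2 w3].
have mE := compatible_formE mc; set l := m e1 f2 in mE.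
have l0 : l != 0.
  apply/eqP => l0; have /nondegenerateP/(_ e1) := mnd.
  move=> e10; have := coE0 fr 0; rewrite e10 ?co0 => [|y].
    by move/esym/eqP; rewrite oner_eq0.
  by rewrite mE l0 mul0r.
have eZ u : l * u = l * 0 -> u = 0 by apply: mulfI.
have tA1 : co 2 (lie e1 f1) + co 3 (lie e1 f2) = 0.
  apply: eZ; have := w1 f1 f2 e1; have := w3 f1 f2 e1.
  rewrite !mE !coordE (lieC e1 f1) (lieC e1 f2) !coN /=; lra.
have tA2 : co 2 (lie e2 f1) + co 3 (lie e2 f2) = 0.
  apply: eZ; have := w1 f1 f2 e2; have := w3 f1 f2 e2.
  rewrite !mE !coordE (lieC e2 f1) (lieC e2 f2) !coN /=; lra.
have tB1 : co 0 (lie e1 f1) + co 1 (lie e2 f1) = 0.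
  apply: eZ; have := w1 e1 e2 f1; have := w3 e1 e2 f1.
  rewrite !mE !coordE /=; lra.
have tB2 : co 0 (lie e1 f2) + co 1 (lie e2 f2) = 0.
  apply: eZ; have := w1 e1 e2 f2; have := w3 e1 e2 f2.
  rewrite !mE !coordE /=; lra.
have Ee := Eint e1 e2; rewrite (adapted_E1 ad) (adapted_E2 ad) in Ee.
have ee2 : co 2 (lie e1 e2) = 0.
  by have := congr1 (co 2) Ee; rewrite !(coD, coN) !coordE; lra.
have ee3 : co 3 (lie e1 e2) = 0.
  by have := congr1 (co 3) Ee; rewrite !(coD, coN) !coordE; lra.
have Ef := Eint f1 f2.
rewrite (adapted_EJ1 ad) (adapted_EJ2 ad) !lieE opprK in Ef.
have ff0 : co 0 (lie f1 f2) = 0.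
  by have := congr1 (co 0) Ef; rewrite !(coD, coN) !coordE; lra.
have ff1 : co 1 (lie f1 f2) = 0.
  by have := congr1 (co 1) Ef; rewrite !(coD, coN) !coordE; lra.
have Je := Jint e1 e2; rewrite (lieC e2 f1) in Je.
have j0 : - co 2 (lie e1 e2) = - co 0 (lie e2 f1) + co 0 (lie e1 f2) - co 2 (lie f1 f2).
  by have := congr1 (co 0) Je; rewrite !(coD, coN) !coordE.
have j1 : - co 3 (lie e1 e2) = - co 1 (lie e2 f1) + co 1 (lie e1 f2) - co 3 (lie f1 f2).
  by have := congr1 (co 1) Je; rewrite !(coD, coN) !coordE.
have j2 : co 0 (lie e1 e2) = - co 2 (lie e2 f1) + co 2 (lie e1 f2) + co 0 (lie f1 f2).
  by have := congr1 (co 2) Je; rewrite !(coD, coN) !coordE.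
have j3 : co 1 (lie e1 e2) = - co 3 (lie e2 f1) + co 3 (lie e1 f2) + co 1 (lie f1 f2).
  by have := congr1 (co 3) Je; rewrite !(coD, coN) !coordE.
clear -fr ad tA1 tA2 tB1 tB2 ee2 ee3 ff0 ff1 j0 j1 j2 j3.
exists (co 2 (lie e1 f1)), (co 2 (lie e1 f2)), (co 3 (lie e1 f1)).
exists (co 2 (lie e2 f1)), (co 2 (lie e2 f2)), (co 3 (lie e2 f1)).
exists (- co 0 (lie e1 f1)), (- co 0 (lie e2 f1)), (- co 1 (lie e1 f1)).
exists (- co 0 (lie e1 f2)), (- co 0 (lie e2 f2)), (- co 1 (lie e1 f2)).
by split; apply: (co_inj fr); rewrite !(coD, coN, coZ) !coordE /=; lra.
Qed.


(** The three groups say that A is flat, that B is flat, and that the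
    polarization of flatness vanishes on the pair A, B; the entries are, up
    to sign, those of the curvature in positions (1, 1), (1, 2) and (2, 1). *)
Lemma brackets_jacobi p q r p' q' r' P Q S P' Q' S' :
  brackets p q r p' q' r' P Q S P' Q' S' ->
  [/\ [/\ q * r' - r * q' = (q - p') * p - (p + r') * p',
         2 * (p * q' - q * p') = (q - p') * q - (p + r') * q' &
         2 * (r * p' - p * r') = (q - p') * r - (p + r') * r'],
      [/\ Q * S' - S * Q' = (Q - P') * P - (P + S') * P',
         2 * (P * Q' - Q * P') = (Q - P') * Q - (P + S') * Q' &
         2 * (S * P' - P * S') = (Q - P') * S - (P + S') * S'] &
      [/\ q * S' - r * Q' - (q' * S - r' * Q) =
           (q - p') * P - (p + r') * P' + (Q - P') * p - (P + S') * p',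
         2 * (p * Q' - q * P') - 2 * (p' * Q - q' * P) =
           (q - p') * Q - (p + r') * Q' + (Q - P') * q - (P + S') * q' &
         2 * (r * P' - p * S') - 2 * (r' * P - p' * S) =
           (q - p') * S - (p + r') * S' + (Q - P') * r - (P + S') * r']].
Proof.
case=> ee ff b11 b12 b21 b22.
pose br := (ee, ff, b11, b12, b21, b22,
  lieC e1 e2, lieC f1 f2, lieC e1 f1, lieC e1 f2, lieC e2 f1, lieC e2 f2,
  liexx e1, liexx e2, liexx f1, liexx f2).
have j1 := lie_jacobi e1 e2 f1; have j2 := lie_jacobi e1 e2 f2.
have j3 := lie_jacobi e1 f1 f2; have j4 := lie_jacobi e2 f1 f2.
rewrite !(br, lieE) in j1 j2 j3 j4.
have {}j1 k := congr1 (co k) j1.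
have {}j2 k := congr1 (co k) j2.
have {}j3 k := congr1 (co k) j3.
have {}j4 k := congr1 (co k) j4.
split; split.
- have := j1 2; rewrite !(coD, coN, coZ, co0) !coordE /=; lra.
- have := j2 2; rewrite !(coD, coN, coZ, co0) !coordE /=; lra.
- have := j1 3; rewrite !(coD, coN, coZ, co0) !coordE /=; lra.
- have := j3 0; rewrite !(coD, coN, coZ, co0) !coordE /=; lra.
- have := j4 0; rewrite !(coD, coN, coZ, co0) !coordE /=; lra.
- have := j3 1; rewrite !(coD, coN, coZ, co0) !coordE /=; lra.
- have h1 := j1 0; rewrite !(coD, coN, coZ, co0) !coordE /= in h1.
  have h2 := j3 2; rewrite !(coD, coN, coZ, co0) !coordE /= in h2; lra.
- have h1 := j2 0; rewrite !(coD, coN, coZ, co0) !coordE /= in h1.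
  have h2 := j4 2; rewrite !(coD, coN, coZ, co0) !coordE /= in h2; lra.
- have h1 := j1 1; rewrite !(coD, coN, coZ, co0) !coordE /= in h1.
  have h2 := j3 3; rewrite !(coD, coN, coZ, co0) !coordE /= in h2; lra.
Qed.

End AdaptedCoordinates.

Section BracketsConverse.
Context {R : realType} {g : lieAlgType R} (J E : 'End(g)) (e1 e2 : g).
Hypothesis ad : adapted J E e1 e2.
Variables (p q r p' q' r' P Q S P' Q' S' : R).
Hypothesis br : brackets J e1 e2 p q r p' q' r' P Q S P' Q' S'.

Local Notation f1 := (J e1).
Local Notation f2 := (J e2).
Local Notation comb := (lc e1 e2 f1 f2).
Local Notation co := (co e1 e2 f1 f2).
Let fr := adapted_frame ad.
Let adE := coordE ad.

Lemma brackets_lc a b c d a' b' c' d' :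
  let m01 := a * b' - b * a' in let m02 := a * c' - c * a' in
  let m03 := a * d' - d * a' in let m12 := b * c' - c * b' in
  let m13 := b * d' - d * b' in let m23 := c * d' - d * c' in
  lie (comb a b c d) (comb a' b' c' d') =
  comb (m01 * (q - p') - m02 * P - m03 * P' - m12 * Q - m13 * Q')
     (- m01 * (p + r') - m02 * S - m03 * S' + m12 * P + m13 * P')
     (m23 * (Q - P') + m02 * p + m03 * q + m12 * p' + m13 * q')
     (- m23 * (P + S') + m02 * r - m03 * p + m12 * r' - m13 * p').
Proof.
case: br => ee ff b11 b12 b21 b22 /=.
by rewrite lie_lc ee ff b11 b12 b21 b22 /lc; module.
Qed.

Let m01 x y := co 0 x * co 1 y - co 1 x * co 0 y.
Let m02 x y := co 0 x * co 2 y - co 2 x * co 0 y.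
Let m03 x y := co 0 x * co 3 y - co 3 x * co 0 y.
Let m12 x y := co 1 x * co 2 y - co 2 x * co 1 y.
Let m13 x y := co 1 x * co 3 y - co 3 x * co 1 y.
Let m23 x y := co 2 x * co 3 y - co 3 x * co 2 y.

Lemma brackets_co x y :
  (co 0 (lie x y) = m01 x y * (q - p') - m02 x y * P - m03 x y * P'
     - m12 x y * Q - m13 x y * Q') *
  (co 1 (lie x y) = - m01 x y * (p + r') - m02 x y * S - m03 x y * S'
     + m12 x y * P + m13 x y * P') *
  (co 2 (lie x y) = m23 x y * (Q - P') + m02 x y * p + m03 x y * q
     + m12 x y * p' + m13 x y * q') *
  (co 3 (lie x y) = - m23 x y * (P + S') + m02 x y * r - m03 x y * p
     + m12 x y * r' - m13 x y * p').
Proof.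
have -> : lie x y = lie (comb (co 0 x) (co 1 x) (co 2 x) (co 3 x))
  (comb (co 0 y) (co 1 y) (co 2 y) (co 3 y)) by rewrite -!(frameE fr).
by rewrite brackets_lc !(co_lc fr) /m01 /m02 /m03 /m12 /m13 /m23.
Qed.

(** The metric for which the frame e1, e2, f1, f2 has e1 dual to f2 and e2 dual
    to - f1. *)
Definition dual_form x y :=
  co 0 x * co 3 y + co 3 x * co 0 y - co 1 x * co 2 y - co 2 x * co 1 y.

Lemma dual_form_bilinear : bilinear_for
  (GRing.Scale.Law.clone _ _ ( *%R) _) (GRing.Scale.Law.clone _ _ (idfun \; *%R) _)
  dual_form.
Proof.
by split=> [u'|u] a x y; rewrite /dual_form !(coD, coZ) /=; ring.
Qed.

Lemma dual_form_sym x y : dual_form x y = (-1) ^+ false * idfun (dual_form y x).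
Proof. by rewrite /dual_form expr0 mul1r /=; ring. Qed.

HB.instance Definition _ := bilinear_isBilinear.Build R g g R _ _ dual_form
  dual_form_bilinear.
HB.instance Definition _ := isHermitianSesquilinear.Build R g false idfun dual_form
  dual_form_sym.

(** The trace-free shape of the structure constants makes every condition an
    identity in them. *)
Lemma brackets_underlying : underlying_cps J E.
Proof.
exists dual_form.
have split_cps : complex_product_structure J E.
  split; [split|split|].
  - by move=> x; apply: (co_inj fr); rewrite !coN !adE.
  - move=> x y; apply: (co_inj fr);
      rewrite !(coD, adE, brackets_co) /m01 /m02 /m03 /m12 /m13 /m23 !adE; ring.
  - move=> E1; have := adapted_EJ1 ad; rewrite E1 id_lfunE => /eq_opp_0 f10.
    by have := coE2 fr 2; rewrite f10 co0 => /esym/eqP; rewrite oner_eq0.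
  - move=> E1; have := adapted_E1 ad; rewrite E1 opp_lfunE id_lfunE => /esym/eq_opp_0 e10.
    by have := coE0 fr 0; rewrite e10 co0 => /esym/eqP; rewrite oner_eq0.
  - by move=> x; apply: (co_inj fr); rewrite !adE ?opprK.
  - move=> x y; apply: (co_inj fr);
      rewrite !(coD, coN, adE, brackets_co) /m01 /m02 /m03 /m12 /m13 /m23 !adE; ring.
  - by move=> x; apply: (co_inj fr); rewrite !(coN, adE) ?opprK.
split=> //.
- split; [|split].
  + apply/nondegenerateP => x x0; apply: (co_inj fr); rewrite co0.
    * by have := x0 f2; rewrite /= /dual_form !adE /=; lra.
    * by have := x0 f1; rewrite /= /dual_form !adE /=; lra.
    * by have := x0 e2; rewrite /= /dual_form !adE /=; lra.
    * by have := x0 e1; rewrite /= /dual_form !adE /=; lra.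
  + by move=> x y; rewrite /= /dual_form !adE; ring.
  + by move=> x y; rewrite /= /dual_form !adE; ring.
- by move=> x y z; rewrite /= /dual_form !adE !brackets_co /m01 /m02 /m03 /m12 /m13 /m23; ring.
- by move=> x y z; rewrite /= /dual_form !adE !brackets_co /m01 /m02 /m03 /m12 /m13 /m23; ring.
- by move=> x y z; rewrite /= /dual_form !adE !brackets_co /m01 /m02 /m03 /m12 /m13 /m23; ring.
Qed.

End BracketsConverse.

Lemma brackets_cps_equiv (R : realType) (g h : lieAlgType R)
    (J E : 'End(g)) (J' E' : 'End(h)) e1 e2 v1 v2 p q r p' q' r' P Q S P' Q' S' :
  adapted J E e1 e2 -> adapted J' E' v1 v2 ->
  brackets J e1 e2 p q r p' q' r' P Q S P' Q' S' ->
  brackets J' v1 v2 p q r p' q' r' P Q S P' Q' S' ->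
  cps_equiv J E J' E'.
Proof.
move=> ad ad' br br'.
apply: (frame_cps_equiv (adapted_frame ad) (adapted_frame ad')) => xi surj xiE.
have flip (V : lieAlgType R) (x y z t : V) a b c d :
    lc z t (- x) (- y) a b c d = lc x y z t (- c) (- d) a b.
  by rewrite /lc; module.
have flipN (V : lieAlgType R) (x y z t : V) a b c d :
    lc x y (- z) (- t) a b c d = lc x y z t a b (- c) (- d).
  by rewrite /lc; module.
split=> [x y|x|x].
- have [a [b [c [d ->]]]] := surj x; have [a' [b' [c' [d' ->]]]] := surj y.
  by rewrite (brackets_lc br) !xiE (brackets_lc br').
- have [a [b [c [d ->]]]] := surj x; rewrite xiE !end_lc.
  rewrite (adapted_J1 ad) (adapted_J2 ad) (adapted_J1 ad') (adapted_J2 ad').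
  by rewrite !flip xiE.
- have [a [b [c [d ->]]]] := surj x; rewrite xiE !end_lc.
  rewrite (adapted_E1 ad) (adapted_E2 ad) (adapted_E1 ad') (adapted_E2 ad').
  rewrite (adapted_EJ1 ad) (adapted_EJ2 ad) (adapted_EJ1 ad') (adapted_EJ2 ad').
  by rewrite !flipN xiE.
Qed.

(** * Normal forms *)

(** A(e1) = [- ma, 0; ca, ma] and A(e2) = [0, 0; ka, 0], and similarly for B:
    both preserve the line of e2.  The last clause is what flatness says about
    such a pair. *)
Definition normal_form (R : realType) (g : lieAlgType R) (J E : 'End(g)) e1 e2
    (ma mb ka kb ca cb : R) : Prop :=
  [/\ adapted J E e1 e2,
      brackets J e1 e2 (- ma) 0 ca 0 0 ka (- mb) 0 cb 0 0 kb &
      (ka = 0 /\ kb = 0) \/ (ka = - ma /\ kb = - mb)].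

Section Elimination.
Variable R : realFieldType.
Implicit Types p q r : R.

(** A flat A with A(e1) e2 - A(e2) e1 = n e2 and n <> 0 preserves the line of
    e2.  Eliminating r q' between the first two equations, both multiplied out
    so that the third applies, leaves 3 n^2 q = 0. *)
Lemma flat_nonabelian p q r q' r' n : n = - (p + r') -> n != 0 ->
  q * r' - r * q' = n * q ->
  2 * (p * q' - q * q) = n * q' ->
  2 * (r * q - p * r') = n * r' ->
  [/\ q = 0, q' = 0 & r' = 0 \/ r' = p].
Proof.
move=> nE n0 F1 F2 F3.
have q0 : q = 0.
  have : n ^+ 2 * q = 0.
    have G1 : r * q' = q * r' - n * q by rewrite -F1; ring.
    have G2 : q * (2 * (r * q - p * r')) = q * (n * r') by rewrite F3.
    have G3 : r * (2 * (p * q' - q * q)) = r * q' * n by rewrite F2; ring.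
    have G4 : r * (2 * (p * q' - q * q)) = r * q' * (2 * p) - 2 * r * q * q by ring.
    rewrite G4 !G1 in G3; rewrite nE in G2 G3 *.
    lra.
  by move/eqP; rewrite mulf_eq0 expf_eq0 /= (negbTE n0) => /eqP.
rewrite q0 in F1 F2 F3.
have /eqP : r' * (r' - p) = 0 by rewrite nE in F3; lra.
rewrite mulf_eq0 subr_eq0 => /orP r'E.
have H : r' = 0 \/ r' = p by case: r'E => /eqP; [left|right].
split=> //; have /eqP : (2 * p - n) * q' = 0 by rewrite mulrBl -F2; ring.
rewrite mulf_eq0 => /orP[/eqP|/eqP//] e.
case/negP: n0; apply/eqP; rewrite nE in e *; case: H e => ->; lra.
Qed.

(** If A is nonabelian and preserves the line of e2, then so does every flat B
    that is compatible with it. *)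
Lemma flat_mixed p r r' P Q P' Q' S' n : n = - (p + r') -> n != 0 ->
  r' = 0 \/ r' = p ->
  2 * (P * Q' - Q * P') = (Q - P') * Q - (P + S') * Q' ->
  r' * Q - r * Q' = n * P' + (Q - P') * p ->
  2 * (p * Q') = n * Q' ->
  [/\ Q = 0, P' = 0 & Q' = 0].
Proof.
move=> nE n0 r'E G M1 M2.
have Q'0 : Q' = 0.
  have /eqP : (2 * p - n) * Q' = 0 by rewrite mulrBl -M2; ring.
  rewrite mulf_eq0 => /orP[/eqP|/eqP//] e.
  by case/negP: n0; apply/eqP; rewrite nE in e *; case: r'E e => ->; lra.
have p0 : p != 0.
  by apply: contra n0 => /eqP p0; apply/eqP; rewrite nE; case: r'E => ->; rewrite p0; lra.
rewrite Q'0 in G M1; rewrite mulr0 subr0 in M1.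
have GQ : Q * (Q + P') = 0 by lra.
case: r'E => r'E; rewrite r'E in M1 nE; rewrite nE in M1.
- have /eqP : p * (Q - 2 * P') = 0 by lra.
  rewrite mulf_eq0 (negbTE p0) /= => /eqP e.
  have QE : Q = 2 * P' by lra.
  have /eqP : P' ^+ 2 = 0 by move: GQ; rewrite QE; lra.
  by rewrite expf_eq0 /= => /eqP P'0; rewrite QE P'0 mulr0.
- have /eqP : p * P' = 0 by lra.
  rewrite mulf_eq0 (negbTE p0) /= => /eqP P'0.
  by move/eqP: GQ; rewrite P'0 addr0 mulf_eq0 orbb => /eqP.
Qed.

(** The hypotheses say that the quadratic form k (k + m) on the plane vanishes;
    as it is a product of linear forms, one of them is zero. *)
Lemma polar_dichotomy (ma mb ka kb : R) :
  ka * (ka + ma) = 0 -> kb * (kb + mb) = 0 ->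
  ma * kb + ka * mb + 2 * ka * kb = 0 ->
  (ka = 0 /\ kb = 0) \/ (ka = - ma /\ kb = - mb).
Proof.
move=> /eqP; rewrite mulf_eq0 addr_eq0 => /orP[]/eqP ka0;
  move=> /eqP; rewrite mulf_eq0 addr_eq0 => /orP[]/eqP kb0; rewrite ka0 kb0.
- by left.
- move=> e; have /eqP : ma * mb = 0 by lra.
  by rewrite mulf_eq0 => /orP[]/eqP->; [right|left]; split; lra.
- move=> e; have /eqP : ma * mb = 0 by lra.
  by rewrite mulf_eq0 => /orP[]/eqP->; [left|right]; split; lra.
- by right.
Qed.

End Elimination.

Section NormalForm.
Context {R : realType} {g : lieAlgType R}.
Implicit Types (J E : 'End(g)) (e v x y : g).

(** When V is a nonabelian subalgebra, the invariant line is [V, V]. *)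
Lemma normal_form_nonabelian J E e1 e2 : \dim {: g} = 4%N ->
  underlying_cps J E -> adapted J E e1 e2 -> lie e1 e2 <> 0 ->
  exists v1 v2 ma mb ka kb ca cb, normal_form J E v1 v2 ma mb ka kb ca cb.
Proof.
move=> dimg cps ad ee0.
have cps' : complex_product_structure J E by case: cps => m [].
have [p [q [r [p' [q' [r' [P [Q [S [P' [Q' [S' br]]]]]]]]]]]] := brackets_exist ad cps.
set u := lie e1 e2 in ee0.
have uE : u = (q - p') *: e1 - (p + r') *: e2 by rewrite /u (br_ee br).
have Eu : E u = u by rewrite uE !endE (adapted_E1 ad) (adapted_E2 ad).
have {p q r p' q' r' P Q S P' Q' S' br uE} [a [b uE]] : exists a b, u = a *: e1 + b *: e2.
  by exists (q - p'), (- (p + r')); rewrite scaleNr.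
have [v1 [n [adv n0 v1u]]] : exists v1 n, [/\ adapted J E v1 u, n != 0 & lie v1 u = n *: u].
  have fr := adapted_pair_free ad.
  have [a0|a0] := eqVneq a 0.
    have b0 : b != 0.
      by apply/eqP => b0; apply: ee0; rewrite uE a0 b0 !scale0r addr0.
    exists e1, b; split=> //; last by rewrite {1}uE !lieE liexx scaler0 add0r.
    apply: adapted_pair => // [x y|]; last exact: (adapted_E1 ad).
    rewrite uE a0 scale0r add0r scalerA => /fr[-> /eqP].
    by rewrite mulf_eq0 (negbTE b0) orbF => /eqP.
  exists e2, (- a); split; rewrite ?oppr_eq0 //; last first.
    by rewrite {1}uE !lieE liexx scaler0 addr0 (lieC e1 e2) scalerN scaleNr.
  apply: adapted_pair => // [x y|]; last exact: (adapted_E2 ad).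
  have -> : x *: e2 + y *: u = (y * a) *: e1 + (x + y * b) *: e2.
    by rewrite uE; module.
  move=> /fr[/eqP]; rewrite mulf_eq0 (negbTE a0) orbF => /eqP->.
  by rewrite mul0r addr0.
have [p [q [r [p' [q' [r' [P [Q [S [P' [Q' [S' br]]]]]]]]]]]] := brackets_exist adv cps.
have [[FA1 FA2 FA3] [FB1 FB2 FB3] [M1 M2 M3]] := brackets_jacobi adv br.
have [qE nE _ _] : [/\ q - p' = 0, - (p + r') = n, (0 : R) = 0 & (0 : R) = 0].
  apply: (lc_inj (adapted_frame adv)); rewrite /lc !scale0r !addr0 add0r.
  by rewrite -v1u (br_ee br) scaleNr.
have p'E : p' = q by lra.
rewrite {p'}p'E in br FA1 FA2 FA3 M1 M2 M3 qE.
rewrite -nE in n0.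
rewrite qE !(mul0r, sub0r, add0r) in FA1 FA2 FA3 M1 M2 M3.
have [q0 q'0 r'E] := flat_nonabelian (erefl _) n0
  (etrans FA1 (esym (mulNr _ _))) (etrans FA2 (esym (mulNr _ _)))
  (etrans FA3 (esym (mulNr _ _))).
rewrite {q}q0 {q'}q'0 in br FA1 FA2 FA3 M1 M2 M3 qE.
have [|| Q0 P'0 Q'0] := @flat_mixed _ p r r' P Q P' Q' S' _ (erefl _) n0 r'E FB2; [lra|lra|].
rewrite {Q}Q0 {P'}P'0 {Q'}Q'0 in br FB1 FB2 FB3 M1 M2 M3.
exists v1, u, (- p), (- P), r', S', r, S; split; [by []|by rewrite !opprK|].
apply: polar_dichotomy; lra.
Qed.

Lemma brackets_swap J e1 e2 p q r p' q' r' P Q S P' Q' S' :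
  brackets J e1 e2 p q r p' q' r' P Q S P' Q' S' ->
  brackets J e2 e1 (- p') r' q' (- p) r q (- P') S' Q' (- P) S Q.
Proof.
case=> ee ff b11 b12 b21 b22; split; rewrite ?b11 ?b12 ?b21 ?b22.
- by rewrite lieC ee; module.
- by rewrite lieC ff; module.
all: module.
Qed.

Lemma adapted_swap J E e1 e2 : \dim {: g} = 4%N ->
  adapted J E e1 e2 -> adapted J E e2 e1.
Proof.
move=> dimg ad; have := adapted_pair_free ad.
case: ad => _ E1 E2 J1 J2 EJ1 EJ2 fr; apply: adapted_intro => // a b.
by rewrite addrC => /fr[-> ->].
Qed.

(** When V and J V are abelian, A and B are symmetric cubic tensors.  Flatness
    makes A the cube of a linear form and the mixed equations make B
    proportional to A; the invariant line is spanned by the values A(v) v, in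
    particular by A(e1) e1 = p e1 + r e2 if this is not zero. *)
Lemma normal_form_abelian J E e1 e2 p q r q' P Q S Q' : \dim {: g} = 4%N ->
  adapted J E e1 e2 ->
  brackets J e1 e2 p q r q q' (- p) P Q S Q Q' (- P) -> ~ (p = 0 /\ r = 0) ->
  exists v1 v2 ma mb ka kb ca cb, normal_form J E v1 v2 ma mb ka kb ca cb.
Proof.
move=> dimg ad br pr0.
have [[FA1 FA2 FA3] [FB1 FB2 FB3] [M1 M2 M3]] := brackets_jacobi ad br.
have {}FA1 : r * q' = - (q * p) by lra.
have {}FA3 : r * q = - (p * p) by lra.
have {}FB3 : S * Q = - (P * P) by lra.
have {}M1 : r * Q' = - (q * P) - q' * S - p * Q by lra.
have {}M3 : r * Q = - (2 * p * P) - q * S by lra.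
have r0 : r != 0.
  apply/eqP => r0; apply: pr0; split=> //; move: FA3; rewrite r0 mul0r.
  by move/esym/eqP; rewrite oppr_eq0 mulf_eq0 orbb => /eqP.
(* All entries are monomials in t = p / r: A is r times, and B is S times, the
   cube of a linear form with kernel t e1 + e2. *)
have [t pE] : exists t, p = r * t by exists (p / r); rewrite mulrCA mulfV ?mulr1.
have qE : q = - (r * t ^+ 2) by apply: (mulfI r0); rewrite FA3 pE; ring.
have q'E : q' = r * t ^+ 3 by apply: (mulfI r0); rewrite FA1 qE pE; ring.
(* r^2 S Q computed in two ways gives a vanishing square. *)
have PE : P = S * t.
  have : r ^+ 2 * (P - S * t) ^+ 2 = 0.
    have : S * (r * (r * Q)) = S * (r * (- (2 * p * P) - q * S)) by rewrite M3.
    have -> : S * (r * (r * Q)) = r ^+ 2 * (S * Q) by ring.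
    by rewrite FB3 qE pE; lra.
  move/eqP; rewrite mulf_eq0 !expf_eq0 /= (negbTE r0) /= subr_eq0; exact/eqP.
have QE : Q = - (S * t ^+ 2).
  by apply: (mulfI r0); rewrite M3 qE PE pE; ring.
have Q'E : Q' = S * t ^+ 3.
  by apply: (mulfI r0); rewrite M1 q'E qE QE PE pE; ring.
have ad' : adapted J E e1 (p *: e1 + r *: e2).
  have fr := adapted_pair_free ad; case: ad => _ E1 E2 J1 J2 EJ1 EJ2.
  apply: adapted_intro; rewrite ?endE ?E1 ?E2 ?J1 ?J2 ?EJ1 ?EJ2 //.
  - move=> a b; rewrite (_ : _ + _ = (a + b * p) *: e1 + (b * r) *: e2); last by module.
    move=> /fr[ab /eqP]; rewrite mulf_eq0 (negbTE r0) orbF => /eqP b0.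
    by move: ab; rewrite b0 mul0r addr0.
  - by module.
  - by module.
exists e1, (p *: e1 + r *: e2), 0, 0, 0, 0, 1, (S / r); split=> //; last by left.
case: br => ee ff b11 b12 b21 b22.
have J1 := adapted_J1 ad; have J2 := adapted_J2 ad.
split; rewrite !(endE, lieE, ee, ff, b11, b12, b21, b22, liexx) ?pE ?PE ?QE ?Q'E ?qE ?q'E.
all: apply: vect_ext => f fD fZ fN f0; rewrite ?(fD, fZ, fN, f0); field.
all: by [].
Qed.

(** Replacing E by - E exchanges V with J V and A with B, which halves the case
    analysis below. *)
Lemma underlying_cps_oppE J E : underlying_cps J E -> underlying_cps J (- E).
Proof.
have oE x : (- E)%VF x = - E x by rewrite opp_lfunE.
case=> m [[cJ [E1 E2 EE EI] JE] [nd [mJ mE]] w1 w2 w3]; exists m; split.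
- split=> //; last by move=> x; rewrite !oE endN JE.
  split=> [||x|x y].
  + by move=> e; apply: E2; rewrite -e opprK.
  + by move=> e; apply: E1; apply: oppr_inj.
  + by rewrite !oE endN opprK EE.
  + by rewrite !oE EI !(lieE, endN); module.
- by split=> //; split=> // x y; rewrite !oE !sformE mE opprK.
- done.
- by move=> x y z; have := w2 x y z; rewrite !oE !sformE; lra.
- by move=> x y z; have := w3 x y z; rewrite !oE !endN !sformE; lra.
Qed.

Lemma adapted_oppE J E e1 e2 : \dim {: g} = 4%N ->
  adapted J E e1 e2 -> adapted J (- E) (J e1) (J e2).
Proof.
move=> dimg ad; have fr := adapted_pair_free ad.
case: ad => _ E1 E2 J1 J2 EJ1 EJ2.
apply: adapted_intro; rewrite // ?opp_lfunE ?J1 ?J2 ?endE ?E1 ?E2 ?EJ1 ?EJ2 ?opprK //.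
move=> a b /(congr1 J); rewrite !endE J1 J2 => ab.
have [|a0 b0] := fr (- a) (- b); first by rewrite -ab; module.
by split; apply: oppr_inj; rewrite ?a0 ?b0 oppr0.
Qed.

Lemma brackets_oppE J E e1 e2 p q r p' q' r' P Q S P' Q' S' :
  adapted J E e1 e2 ->
  brackets J e1 e2 p q r p' q' r' P Q S P' Q' S' ->
  brackets J (J e1) (J e2) P Q S P' Q' S' (- p) (- q) (- r) (- p') (- q') (- r').
Proof.
move=> ad [ee ff b11 b12 b21 b22].
have J1 := adapted_J1 ad; have J2 := adapted_J2 ad.
split; rewrite ?J1 ?J2 ?lieE ?ff ?ee.
- module.
- module.
- by rewrite lieC b11; module.
- by rewrite (lieC e2) b21; module.
- by rewrite (lieC e1) b12; module.
- by rewrite (lieC e2) b22; module.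
Qed.

Lemma normal_form_oppE J E e1 e2 ma mb ka kb ca cb : \dim {: g} = 4%N ->
  normal_form J (- E) e1 e2 ma mb ka kb ca cb ->
  normal_form J E (J e1) (J e2) mb (- ma) kb (- ka) cb (- ca).
Proof.
move=> dimg [ad br k]; split; last by case: k => -[-> ->]; [left|right]; rewrite ?oppr0.
  by rewrite -[E]opprK; apply: adapted_oppE.
by have := brackets_oppE ad br; rewrite oppr0.
Qed.

Lemma normal_form_exists J E : \dim {: g} = 4%N -> underlying_cps J E ->
  exists v1 v2 ma mb ka kb ca cb, normal_form J E v1 v2 ma mb ka kb ca cb.
Proof.
move=> dimg cps.
have cps' : complex_product_structure J E by case: cps => m [].
have [e1 [e2 ad]] := adapted_exists dimg cps'.
(* In the frame f1, f2 for - E the roles of A and B are exchanged. *)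
have adN := adapted_oppE dimg ad.
have cpsN := underlying_cps_oppE cps.
have [ee|/eqP ee] := eqVneq (lie e1 e2) 0; last exact: normal_form_nonabelian ee.
have wlog_oppE : (exists v1 v2 ma mb ka kb ca cb,
    normal_form J (- E) v1 v2 ma mb ka kb ca cb) ->
  exists v1 v2 ma mb ka kb ca cb, normal_form J E v1 v2 ma mb ka kb ca cb.
  case=> v1 [v2 [ma [mb [ka [kb [ca [cb /(normal_form_oppE dimg) nf]]]]]]].
  by do 8 eexists; exact: nf.
have [ff|/eqP ff] := eqVneq (lie (J e1) (J e2)) 0; last first.
  exact/wlog_oppE/(normal_form_nonabelian dimg cpsN adN ff).
have [p [q [r [p' [q' [r' [P [Q [S [P' [Q' [S' br]]]]]]]]]]]] := brackets_exist ad cps.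
have [qE r'E _ _] : [/\ q - p' = 0, - (p + r') = 0, (0 : R) = 0 & (0 : R) = 0].
  apply: (lc_inj (adapted_frame ad)); rewrite /lc !scale0r !addr0 scaleNr.
  by rewrite -(br_ee br).
have [_ _ QE S'E] : [/\ (0 : R) = 0, (0 : R) = 0, Q - P' = 0 & - (P + S') = 0].
  apply: (lc_inj (adapted_frame ad)); rewrite /lc !scale0r !addr0 add0r scaleNr.
  by rewrite -(br_ff br).
have {}qE : p' = q by lra.
have {}r'E : r' = - p by lra.
have {}QE : P' = Q by lra.
have {}S'E : S' = - P by lra.
rewrite {p'}qE {r'}r'E {P'}QE {S'}S'E in br.
have [pr|pr] := pselect (p = 0 /\ r = 0); last exact: normal_form_abelian br pr.
have [pr'|pr'] := pselect (- q = 0 /\ q' = 0); last first.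
  apply: (@normal_form_abelian _ _ _ _ _ (- p) _ r (- Q) (- P) Q' S
    dimg (adapted_swap dimg ad) _ pr').
  by have := brackets_swap br; rewrite !opprK.
have brN := brackets_oppE ad br.
have [PS|PS] := pselect (P = 0 /\ S = 0); last first.
  apply/wlog_oppE/(@normal_form_abelian _ _ _ _ _ Q _ Q' (- p) (- q) (- r) (- q')
    dimg adN _ PS).
  exact: brN.
have [PS'|PS'] := pselect (- Q = 0 /\ Q' = 0); last first.
  apply/wlog_oppE/(@normal_form_abelian _ _ _ _ _ (- P) _ S q p (- q') (- r)
    dimg (adapted_swap dimg adN) _ PS').
  by have := brackets_swap brN; rewrite !opprK.
exists e1, e2, 0, 0, 0, 0, 0, 0; split=> //; last by left.
have q0 : q = 0 by case: pr'; lra.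
have Q0 : Q = 0 by case: PS'; lra.
move: br; case: pr => -> ->; case: PS => -> ->; case: pr' => _ ->; case: PS' => _ ->.
by rewrite q0 Q0 !oppr0.
Qed.

End NormalForm.

(** The changes of basis of V that preserve the line of e2. *)
Lemma normal_form_change (R : realType) (g : lieAlgType R) (J E : 'End(g))
    e1 e2 ma mb ka kb ca cb p q s : \dim {: g} = 4%N -> p != 0 -> q != 0 ->
  normal_form J E e1 e2 ma mb ka kb ca cb ->
  normal_form J E (p *: e1 + s *: e2) (q *: e2) (p * ma) (p * mb) (p * ka) (p * kb)
    (p / q * (p * ca + s * (2 * ma + ka))) (p / q * (p * cb + s * (2 * mb + kb))).
Proof.
move=> dimg p0 q0 [ad br k]; split.
- have fr := adapted_pair_free ad; case: ad => _ E1 E2 J1 J2 EJ1 EJ2.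
  apply: adapted_intro; rewrite ?endE ?E1 ?E2 ?J1 ?J2 ?EJ1 ?EJ2 //; try by module.
  move=> a b; rewrite (_ : _ + _ = (a * p) *: e1 + (a * s + b * q) *: e2); last by module.
  move=> /fr[/eqP]; rewrite mulf_eq0 (negbTE p0) orbF => /eqP->.
  by rewrite mul0r add0r => /eqP; rewrite mulf_eq0 (negbTE q0) orbF => /eqP.
- case: br => ee ff b11 b12 b21 b22.
  split; rewrite !(endE, lieE, lieC e1 e2, lieC (J e1) (J e2), ee, ff, b11, b12, b21,
    b22, liexx); apply: vect_ext => f fD fZ fN f0; rewrite ?(fD, fZ, fN, f0);
    by field; rewrite ?p0 ?q0.
- by case: k => -[-> ->]; [left|right]; rewrite ?mulr0 ?mulrN.
Qed.

(** * Structures with given invariants *)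

(** Invariants that agree up to a factor x for m and k, and up to a factor y
    and a multiple of m for c, come from equivalent structures. *)
Lemma normal_form_equiv (R : realType) (g h : lieAlgType R)
    (J E : 'End(g)) (J' E' : 'End(h)) e1 e2 v1 v2 ma mb ka kb ca cb x y z :
  \dim {: g} = 4%N -> x != 0 -> y != 0 ->
  normal_form J' E' v1 v2 ma mb ka kb ca cb ->
  normal_form J E e1 e2 (x * ma) (x * mb) (x * ka) (x * kb)
    (y * ca + z * ma) (y * cb + z * mb) ->
  cps_equiv J E J' E'.
Proof.
move=> dimg x0 y0 [ad' br' k'] nf.
have [l l0 [la lb]] : exists2 l, l != 0 &
    2 * (x * ma) + x * ka = l * (x * ma) /\ 2 * (x * mb) + x * kb = l * (x * mb).
  case: k' => -[-> ->].
    by exists 2; [rewrite pnatr_eq0|split; ring].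
  by exists 1; [exact: oner_neq0|split; ring].
have q0 : x ^- 2 * y != 0 by rewrite mulf_neq0 // invr_eq0 expf_eq0.
have xV0 : x^-1 != 0 by rewrite invr_eq0.
have [ad br _] := normal_form_change (- (x^-1 * z / (l * x))) dimg xV0 q0 nf.
apply: (brackets_cps_equiv ad ad' _ br'); move: br; rewrite la lb !mulKf //.
have -> : x^-1 / (x ^- 2 * y) * (x^-1 * (y * ca + z * ma)
  + - (x^-1 * z / (l * x)) * (l * (x * ma))) = ca by field; rewrite x0 y0 l0.
have -> // : x^-1 / (x ^- 2 * y) * (x^-1 * (y * cb + z * mb)
  + - (x^-1 * z / (l * x)) * (l * (x * mb))) = cb by field; rewrite x0 y0 l0.
Qed.

(** Lines in the plane are parametrized by half of an angle in [0, 2 pi). *)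
Lemma half_polar (R : realType) (x y : R) : (x != 0) || (y != 0) ->
  exists r t, [/\ r != 0, 0 <= t < 2 * pi, x = r * cos (t / 2) & y = r * sin (t / 2)].
Proof.
move=> xy0.
wlog y_ge0 : x y xy0 / 0 <= y.
  move=> H; have [|/ltW y_le0] := leP 0 y; first exact: H.
  have [||r [t [r0 t_int xE yE]]] := H (- x) (- y).
  - by rewrite !oppr_eq0.
  - by rewrite oppr_ge0.
  by exists (- r), t; split; rewrite ?oppr_eq0 // mulNr -?xE -?yE opprK.
have [y0|y0] := eqVneq y 0.
  exists x, 0; rewrite y0 eqxx orbF in xy0 *.
  by rewrite mul0r cos0 sin0 mulr1 mulr0 lexx mulr_gt0 // pi_gt0.
have {y0} y_gt0 : 0 < y by rewrite lt_def y0.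
have N_gt0 : 0 < x ^+ 2 + y ^+ 2 by rewrite ltr_wpDl ?sqr_ge0 // exprn_gt0.
set r := Num.sqrt (x ^+ 2 + y ^+ 2).
have r_gt0 : 0 < r by rewrite sqrtr_gt0.
have r2 : r ^+ 2 = x ^+ 2 + y ^+ 2 by rewrite sqr_sqrtr // ltW.
have xr2 : (x / r) ^+ 2 + (y / r) ^+ 2 = 1.
  by rewrite !expr_div_n -mulrDl -r2 mulfV // expf_neq0 // gt_eqF.
have yr_gt0 : 0 < y / r by rewrite divr_gt0.
have xr_lt1 : -1 < x / r < 1.
  have : (x / r) ^+ 2 < 1 by rewrite -xr2 ltrDl exprn_gt0.
  by rewrite -[_ ^+ 2]real_normK ?num_real // expr_lt1 // ltr_norml.
have xr_le1 : -1 <= x / r <= 1 by case/andP: xr_lt1 => /ltW-> /ltW->.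
exists r, (2 * acos (x / r)).
rewrite (mulrC 2) mulfK ?pnatr_eq0 // acosK ?in_itv //= sin_acos //.
split.
- by rewrite gt_eqF.
- rewrite mulr_ge0 ?acos_ge0 //= (mulrC 2) ltr_pM2r ?ltr0n // acos_ltpi //.
  by case/andP: xr_lt1 => -> /ltW->.
- by rewrite mulrC divfK // gt_eqF.
- have -> : 1 - (x / r) ^+ 2 = (y / r) ^+ 2 by rewrite -xr2; ring.
  by rewrite sqrtr_sqr gtr0_norm // mulrC divfK // gt_eqF.
Qed.

Lemma half_angle (R : realType) (t : R) (C := cos (t / 2)) (S := sin (t / 2)) :
  [/\ cos t = C ^+ 2 - S ^+ 2, sin t = 2 * C * S & C ^+ 2 + S ^+ 2 = 1].
Proof.
have tE : t = t / 2 + t / 2 by rewrite -splitr.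
by split; rewrite ?cos2Dsin2 // {1}tE ?cosD ?sinD /C /S; ring.
Qed.

Section ModelCoordinates.
Variable R : realType.

Definition vec (a b c d : R) : 'cV[R]_4 := \col_i nth 0 [:: a; b; c; d] i.

Lemma vecE a b c d (x := vec a b c d) :
  (x (inord 0) 0 = a) * (x (inord 1) 0 = b) * (x (inord 2) 0 = c) *
  (x (inord 3) 0 = d).
Proof. by rewrite /x /vec !mxE !inordK. Qed.

Lemma endo_of_coord (s : 'I_4 -> 'I_4) (X : 4.-tuple 'cV[R]_4) (M : 'M[R]_4) u k :
  injective s -> (forall i : 'I_4, X`_i = v_ R (s i)) ->
  endo_of X M u (s k) 0 = \sum_j M k j * u (s j) 0.
Proof.
move=> sI XE; have XB := v_basis sI XE.
have XEs (i j : 'I_4) : X`_i (s j) 0 = (i == j)%:R.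
  by rewrite XE !mxE (inj_eq val_inj) (inj_eq sI) eq_sym.
have uE := coord_basis XB (memvf u).
have cE j : coord X j u = u (s j) 0.
  rewrite {2}uE summxE (bigD1 j) //= mxE XEs eqxx mulr1 big1 ?addr0 // => i ij.
  by rewrite mxE XEs (negbTE ij) mulr0.
rewrite {1}uE linear_sum summxE; apply: eq_bigr => j _.
rewrite linearZ /= mxE endo_ofE // summxE mulrC -cE; congr (_ * _).
rewrite (bigD1 k) //= mxE XEs eqxx mulr1 big1 ?addr0 // => i ik.
by rewrite mxE XEs (negbTE ik) mulr0.
Qed.

Definition row4 (r : seq R) (x : 'cV[R]_4) a b c d : R :=
  nth 0 r 0 * x (inord a) 0 + nth 0 r 1 * x (inord b) 0 +
  nth 0 r 2 * x (inord c) 0 + nth 0 r 3 * x (inord d) 0.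

Lemma endo_mx4 (X : 4.-tuple 'cV[R]_4) (a b c d : nat) r0 r1 r2 r3 u
    (E := endo_of X (mx4 [:: r0; r1; r2; r3])) :
  perm_eq [:: a; b; c; d] (iota 0 4) ->
  X = [tuple v_ R a; v_ R b; v_ R c; v_ R d] ->
  (E u (inord a) 0 = row4 r0 u a b c d) * (E u (inord b) 0 = row4 r1 u a b c d) *
  (E u (inord c) 0 = row4 r2 u a b c d) * (E u (inord d) 0 = row4 r3 u a b c d).
Proof.
move=> abcd XE.
pose s (i : 'I_4) : 'I_4 := inord (nth 0%N [:: a; b; c; d] i).
have lt4 i : (i < 4)%N -> (nth 0%N [:: a; b; c; d] i < 4)%N.
  move=> i4; have := mem_nth 0%N (s := [:: a; b; c; d]) i4.
  by rewrite (perm_mem abcd) mem_iota.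
have sI : injective s.
  move=> i j /(congr1 val); rewrite /s /= !inordK ?lt4 // => /eqP.
  rewrite nth_uniq // ?(perm_uniq abcd) ?iota_uniq // => /eqP; exact: val_inj.
have Xs (i : 'I_4) : X`_i = v_ R (s i).
  rewrite /s inordK ?lt4 // XE.
  by case: i => [[|[|[|[|//]]]]] i4.
have H k : E u (s k) 0 = row4 (nth [::] [:: r0; r1; r2; r3] k) u a b c d.
  rewrite (endo_of_coord _ _ _ sI Xs) !big_ord_recl big_ord0 addr0 !mxE !addrA.
  by rewrite /row4 /s /=.
by do !split; [have := H (@Ordinal 4 0 isT)|have := H (@Ordinal 4 1 isT)|
  have := H (@Ordinal 4 2 isT)|have := H (@Ordinal 4 3 isT)].
Qed.

Lemma endo_gh1E r0 r1 r2 r3 (u : gh1 R)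
    (E := endo_of (basis_gh1 R) (mx4 [:: r0; r1; r2; r3])) :
  ((E u : 'cV[R]_4) (inord 0) 0 = row4 r0 u 0 1 2 3) *
  ((E u : 'cV[R]_4) (inord 1) 0 = row4 r1 u 0 1 2 3) *
  ((E u : 'cV[R]_4) (inord 2) 0 = row4 r2 u 0 1 2 3) *
  ((E u : 'cV[R]_4) (inord 3) 0 = row4 r3 u 0 1 2 3).
Proof. exact: endo_mx4. Qed.

Lemma endo_gh0E r0 r1 r2 r3 (u : gh0 R)
    (E := endo_of (basis_gh0 R) (mx4 [:: r0; r1; r2; r3])) :
  ((E u : 'cV[R]_4) (inord 1) 0 = row4 r0 u 1 2 3 0) *
  ((E u : 'cV[R]_4) (inord 2) 0 = row4 r1 u 1 2 3 0) *
  ((E u : 'cV[R]_4) (inord 3) 0 = row4 r2 u 1 2 3 0) *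
  ((E u : 'cV[R]_4) (inord 0) 0 = row4 r3 u 1 2 3 0).
Proof. exact: endo_mx4. Qed.

Lemma endo_gh2E r0 r1 r2 r3 (u : gh2 R)
    (E := endo_of (basis_gh2 R) (mx4 [:: r0; r1; r2; r3])) :
  ((E u : 'cV[R]_4) (inord 0) 0 = row4 r0 u 0 2 1 3) *
  ((E u : 'cV[R]_4) (inord 2) 0 = row4 r1 u 0 2 1 3) *
  ((E u : 'cV[R]_4) (inord 1) 0 = row4 r2 u 0 2 1 3) *
  ((E u : 'cV[R]_4) (inord 3) 0 = row4 r3 u 0 2 1 3).
Proof. exact: endo_mx4. Qed.

End ModelCoordinates.

Local Notation "x '@' k" := ((x : 'cV[_]_4) (inord k) 0) (at level 9, k at level 8).

Section ModelNormalForms.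
Variable R : realType.

Lemma lie_gh0E (x y : gh0 R) :
  ((lie x y)@0 = 0) * ((lie x y)@1 = 0) * ((lie x y)@2 = 0) *
  ((lie x y)@3 = x@1 * y@2 - x@2 * y@1).
Proof. exact: table_gh0E. Qed.

Lemma lie_gh1E (x y : gh1 R) :
  ((lie x y)@0 = 0) * ((lie x y)@1 = x@0 * y@1 - x@1 * y@0) *
  ((lie x y)@2 = - (x@0 * y@2 - x@2 * y@0)) *
  ((lie x y)@3 = - (x@0 * y@3 - x@3 * y@0)).
Proof. exact: table_gh1E. Qed.

Lemma lie_gh2E (x y : gh2 R) :
  ((lie x y)@0 = 0) * ((lie x y)@1 = 2 * (x@0 * y@1 - x@1 * y@0)) *
  ((lie x y)@2 = - (x@0 * y@2 - x@2 * y@0)) *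
  ((lie x y)@3 = x@0 * y@3 - x@3 * y@0 + (x@1 * y@2 - x@2 * y@1)).
Proof. exact: table_gh2E. Qed.

Lemma coord_add (x y : 'cV[R]_4) i : (x + y) i 0 = x i 0 + y i 0.
Proof. by rewrite mxE. Qed.
Lemma coord_scale a (x : 'cV[R]_4) i : (a *: x) i 0 = a * x i 0.
Proof. by rewrite mxE. Qed.
Lemma coord_opp (x : 'cV[R]_4) i : (- x) i 0 = - x i 0.
Proof. by rewrite mxE. Qed.
Lemma coord_0 i : (0 : 'cV[R]_4) i 0 = 0.
Proof. by rewrite mxE. Qed.
Definition linE := (coord_add, coord_scale, coord_opp, coord_0).

Lemma dim_gh1 : \dim {: gh1 R} = 4%N.
Proof. by rewrite dimvf. Qed.

(** Equality modulo the relation C^2 + S^2 = 1, with the cofactor k given. *)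
Lemma mod_circle (C S k x y : R) : C ^+ 2 + S ^+ 2 = 1 ->
  x - y = k * (C ^+ 2 + S ^+ 2 - 1) -> x = y.
Proof. by move=> -> /eqP; rewrite subrr mulr0 subr_eq0 => /eqP. Qed.

Lemma dim_gh0 : \dim {: gh0 R} = 4%N. Proof. by rewrite dimvf. Qed.
Lemma dim_gh2 : \dim {: gh2 R} = 4%N. Proof. by rewrite dimvf. Qed.

Lemma row4E x y z w (u : 'cV[R]_4) a b c d :
  row4 [:: x; y; z; w] u a b c d = x * u@a + y * u@b + z * u@c + w * u@d.
Proof. by []. Qed.

Lemma circle_free (C S a : R) : C ^+ 2 + S ^+ 2 = 1 ->
  a * C = 0 -> a * S = 0 -> a = 0.
Proof. by move=> CS aC aS; rewrite -[a]mulr1 -CS mulrDr !mulrA aC aS !mul0r addr0. Qed.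

Lemma vec_add (a b c d a' b' c' d' : R) :
  vec a b c d + vec a' b' c' d' = vec (a + a') (b + b') (c + c') (d + d') :> 'cV[R]_4.
Proof. by apply: coord4P; rewrite !(linE, vecE). Qed.

Lemma vec_scale (k a b c d : R) : k *: vec a b c d = vec (k * a) (k * b) (k * c) (k * d).
Proof. by apply: coord4P; rewrite !(linE, vecE). Qed.

Lemma vec_opp (a b c d : R) : - vec a b c d = vec (- a) (- b) (- c) (- d).
Proof. by apply: coord4P; rewrite !(linE, vecE). Qed.

Lemma vec_eq0 (a b c d : R) : vec a b c d = 0 <-> [/\ a = 0, b = 0, c = 0 & d = 0].
Proof.
split=> [e|[-> -> -> ->]]; last by apply: coord4P; rewrite !(linE, vecE).
by have := vecE a b c d; rewrite /= e !linE => -[[[<- <-] <-] <-].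
Qed.

Lemma lie_gh0_vec a b c d a' b' c' d' :
  lie (vec a b c d : gh0 R) (vec a' b' c' d' : gh0 R) = vec 0 0 0 (b * c' - c * b').
Proof. by apply: coord4P; rewrite !(lie_gh0E, vecE). Qed.

Lemma lie_gh1_vec a b c d a' b' c' d' :
  lie (vec a b c d : gh1 R) (vec a' b' c' d' : gh1 R) =
  vec 0 (a * b' - b * a') (- (a * c' - c * a')) (- (a * d' - d * a')).
Proof. by apply: coord4P; rewrite !(lie_gh1E, vecE). Qed.

Lemma lie_gh2_vec a b c d a' b' c' d' :
  lie (vec a b c d : gh2 R) (vec a' b' c' d' : gh2 R) =
  vec 0 (2 * (a * b' - b * a')) (- (a * c' - c * a'))
    (a * d' - d * a' + (b * c' - c * b')).
Proof. by apply: coord4P; rewrite !(lie_gh2E, vecE). Qed.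

Lemma J0_vec a b c d :
  endo_of (basis_gh0 R) J0 (vec a b c d : gh0 R) = vec d (- c) b (- a).
Proof. by apply: coord4P; rewrite /J0 !(endo_gh0E, row4E, vecE); ring. Qed.

Lemma E0_vec t a b c d :
  endo_of (basis_gh0 R) (E0 t) (vec a b c d : gh0 R) =
  vec (sin t * d - cos t * a) b (- c) (cos t * d + sin t * a).
Proof. by apply: coord4P; rewrite /E0 !(endo_gh0E, row4E, vecE); ring. Qed.

Lemma J1_vec a b c d :
  endo_of (basis_gh1 R) J1 (vec a b c d : gh1 R) = vec (- b) a (- d) c.
Proof. by apply: coord4P; rewrite /J1 !(endo_gh1E, row4E, vecE); ring. Qed.

Lemma E1_vec t e a b c d :
  endo_of (basis_gh1 R) (E1 t e) (vec a b c d : gh1 R) =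
  vec (cos t * a + sin t * b) (sin t * a - cos t * b)
    (e * (1 + cos t) * b - e * sin t * a + c) (e * (1 + cos t) * a + e * sin t * b - d).
Proof. by apply: coord4P; rewrite /E1 !(endo_gh1E, row4E, vecE); ring. Qed.

Lemma E1_exc_vec a b c d :
  endo_of (basis_gh1 R) E1_exc (vec a b c d : gh1 R) =
  vec (- a) b (c - 2 * a) (2 * b - d).
Proof. by apply: coord4P; rewrite /E1_exc !(endo_gh1E, row4E, vecE); ring. Qed.

Lemma J2_vec a b c d :
  endo_of (basis_gh2 R) J2 (vec a b c d : gh2 R) = vec c (- d) (- a) b.
Proof. by apply: coord4P; rewrite /J2 !(endo_gh2E, row4E, vecE); ring. Qed.

Lemma E2_vec t e a b c d :
  endo_of (basis_gh2 R) (E2 t e) (vec a b c d : gh2 R) =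
  vec (cos t * a + sin t * c)
    (e * (1 + cos t) * (sin t * a - cos t * c) + cos t * b - sin t * d)
    (sin t * a - cos t * c)
    (e * (1 + cos t) * (cos t * a + sin t * c) - sin t * b - cos t * d).
Proof. by apply: coord4P; rewrite /E2 !(endo_gh2E, row4E, vecE); ring. Qed.

Lemma E2_exc_vec a b c d :
  endo_of (basis_gh2 R) E2_exc (vec a b c d : gh2 R) =
  vec (- a) (2 * c - b) c (d - 2 * a).
Proof. by apply: coord4P; rewrite /E2_exc !(endo_gh2E, row4E, vecE); ring. Qed.

Ltac mod_circle CS k := apply: (@mod_circle _ _ k _ _ CS); ring.
Ltac circle C S d CS := first
  [ ring | mod_circle CS (1 : R) | mod_circle CS (- 1 : R)
  | mod_circle CS C | mod_circle CS S | mod_circle CS (- C) | mod_circle CS (- S)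
  | mod_circle CS (d * C) | mod_circle CS (d * S) | mod_circle CS (- d * C)
  | mod_circle CS (- d * S)
  | mod_circle CS (d * C ^+ 3) | mod_circle CS (d * C ^+ 2 * S)
  | mod_circle CS (- d * C ^+ 3) | mod_circle CS (- d * C ^+ 2 * S) ].

(** In each model the vectors are chosen in the +1 eigenspace of E, with the
    second one in the invariant line; C and S appear because a reflection with
    angle t fixes the direction t / 2. *)
Lemma gh0_normal_form t (C := cos (t / 2)) (S := sin (t / 2)) :
  normal_form (endo_of (basis_gh0 R) J0) (endo_of (basis_gh0 R) (E0 t))
    (vec 0 1 0 0 : gh0 R) (vec S 0 0 C : gh0 R)
    0 0 0 0 (- S) (- C).
Proof.
have [cE sE CS] := half_angle t; rewrite -/C -/S in cE sE CS.
pose rules := (vec_add, vec_scale, vec_opp, lie_gh0_vec, J0_vec, E0_vec).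
split; [|by split; rewrite !rules; congr vec; circle C S (0 : R) CS|by left].
apply: adapted_intro; first exact: dim_gh0.
  move=> a b; rewrite !rules => /vec_eq0[c0 c1 c2 c3].
  by split; [lra|apply: (circle_free CS); lra].
all: by rewrite !rules ?cE ?sE; congr vec; circle C S (0 : R) CS.
Qed.

Lemma gh1_normal_form t d (C := cos (t / 2)) (S := sin (t / 2)) :
  normal_form (endo_of (basis_gh1 R) J1) (endo_of (basis_gh1 R) (E1 t d))
    (vec C S 0 (d * C) : gh1 R) (vec 0 0 1 0 : gh1 R)
    (- C) S 0 0 (- 2 * d * C * S) (- 2 * d * C ^+ 2).
Proof.
have [cE sE CS] := half_angle t; rewrite -/C -/S in cE sE CS.
pose rules := (vec_add, vec_scale, vec_opp, lie_gh1_vec, J1_vec, E1_vec).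
split; [|by split; rewrite !rules; congr vec; circle C S d CS|by left].
apply: adapted_intro; first exact: dim_gh1.
  move=> a b; rewrite !rules => /vec_eq0[c0 c1 c2 c3].
  by split; [apply: (circle_free CS); lra|lra].
all: by rewrite !rules ?cE ?sE; congr vec; circle C S d CS.
Qed.

Lemma gh1_exc_normal_form :
  normal_form (endo_of (basis_gh1 R) J1) (endo_of (basis_gh1 R) E1_exc)
    (vec 0 1 0 1 : gh1 R) (vec 0 0 1 0 : gh1 R)
    0 1 0 0 (- 2) 0.
Proof.
pose rules := (vec_add, vec_scale, vec_opp, lie_gh1_vec, J1_vec, E1_exc_vec).
split; [|by split; rewrite !rules; congr vec; ring|by left].
apply: adapted_intro; first exact: dim_gh1.
  move=> a b; rewrite !rules => /vec_eq0[c0 c1 c2 c3].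
  by split; lra.
all: by rewrite !rules; congr vec; ring.
Qed.

Lemma gh2_normal_form t d (C := cos (t / 2)) (S := sin (t / 2)) :
  normal_form (endo_of (basis_gh2 R) J2) (endo_of (basis_gh2 R) (E2 t d))
    (vec C (d * C ^+ 2 * S) S (d * C ^+ 3) : gh2 R) (vec 0 C 0 (- S) : gh2 R)
    C S (- C) (- S) (- 3 * d * C ^+ 2 * S) (3 * d * C ^+ 3).
Proof.
have [cE sE CS] := half_angle t; rewrite -/C -/S in cE sE CS.
have c1 : 1 + cos t = 2 * C ^+ 2 by rewrite cE; lra.
pose rules := (vec_add, vec_scale, vec_opp, lie_gh2_vec, J2_vec, E2_vec).
split; [|by split; rewrite !rules; congr vec; circle C S d CS|by right].
apply: adapted_intro; first exact: dim_gh2.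
  move=> a b; rewrite !rules => /vec_eq0[c0 c1' c2 c3].
  have a0 : a = 0 by apply: (circle_free CS); lra.
  split=> //; rewrite a0 !mul0r !add0r in c1' c3.
  by apply: (circle_free CS); lra.
all: by rewrite !rules ?c1 ?cE ?sE; congr vec; circle C S d CS.
Qed.

Lemma gh2_exc_normal_form :
  normal_form (endo_of (basis_gh2 R) J2) (endo_of (basis_gh2 R) E2_exc)
    (vec 0 1 1 0 : gh2 R) (vec 0 0 0 (- 1) : gh2 R)
    0 1 0 (- 1) (- 3) 0.
Proof.
pose rules := (vec_add, vec_scale, vec_opp, lie_gh2_vec, J2_vec, E2_exc_vec).
split; [|by split; rewrite !rules; congr vec; ring|by right; rewrite oppr0].
apply: adapted_intro; first exact: dim_gh2.
  move=> a b; rewrite !rules => /vec_eq0[c0 c1 c2 c3].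
  by split; lra.
all: by rewrite !rules; congr vec; ring.
Qed.

End ModelNormalForms.

(** * Classification *)

Lemma normal_form_underlying (R : realType) (g : lieAlgType R) (J E : 'End(g))
    e1 e2 ma mb ka kb ca cb :
  normal_form J E e1 e2 ma mb ka kb ca cb -> underlying_cps J E.
Proof. by case=> ad br _; apply: brackets_underlying ad _ _ _ _ _ _ _ _ _ _ _ _ br. Qed.

Section Flat.
Variable R : realType.

Definition basis_flat : 4.-tuple (abelian4 R) :=
  [tuple v_ R 0; v_ R 1; v_ R 2; v_ R 3].

Lemma basis_flatP : basis_of fullv basis_flat.
Proof. exact: basis_gh1P. Qed.

Lemma mx2_split (A B C D : 'M[R]_2) : (block_mx A B C D : 'M[R]_4) = mx4
  [:: [:: A 0 0; A 0 1; B 0 0; B 0 1]; [:: A 1 0; A 1 1; B 1 0; B 1 1];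
      [:: C 0 0; C 0 1; D 0 0; D 0 1]; [:: C 1 0; C 1 1; D 1 0; D 1 1]].
Proof.
have i4 (i : 'I_4) : [\/ i = lshift 2 (0 : 'I_2), i = lshift 2 (1 : 'I_2),
    i = rshift 2 (0 : 'I_2) | i = rshift 2 (1 : 'I_2)].
  by case: i => [[|[|[|[|//]]]]] i4; [constructor 1|constructor 2|constructor 3|
    constructor 4]; apply: val_inj.
apply/matrixP => i j.
by case: (i4 i) => ->; case: (i4 j) => ->;
  rewrite [RHS]mxE /=; first [exact: block_mxEul|exact: block_mxEur
    |exact: block_mxEdl|exact: block_mxEdr].
Qed.

Lemma endo_flatE r0 r1 r2 r3 (u : abelian4 R)
    (E := endo_of basis_flat (mx4 [:: r0; r1; r2; r3])) :
  ((E u)@0 = row4 r0 u 0 1 2 3) * ((E u)@1 = row4 r1 u 0 1 2 3) *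
  ((E u)@2 = row4 r2 u 0 1 2 3) * ((E u)@3 = row4 r3 u 0 1 2 3).
Proof. exact: endo_mx4. Qed.

Lemma lie_flat (x y : abelian4 R) : lie x y = 0.
Proof.
have a0 : table_lie (@table_a R) x y = 0 by rewrite table_lieE !scaler0 !addr0.
exact: a0.
Qed.

Lemma flat_normal_form :
  normal_form (endo_of basis_flat Jflat) (endo_of basis_flat Eflat)
    (vec 1 0 0 0 : abelian4 R) (vec 0 1 0 0 : abelian4 R) 0 0 0 0 0 0.
Proof.
rewrite /Jflat /Eflat !mx2_split !mxE /=.
pose rules := (@linE R, endo_flatE, @row4E R, @vecE R).
split; [|by split; rewrite lie_flat; apply: coord4P; rewrite !rules; ring|by left].
apply: adapted_intro; first by rewrite dimvf.
  move=> a b ab0.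
  have c k : (a *: (vec 1 0 0 0 : abelian4 R) + b *: (vec 0 1 0 0 : abelian4 R))@k = 0.
    by rewrite ab0 linE.
  have := c 0%N; have := c 1%N; rewrite !rules => c1 c0.
  by split; lra.
all: by apply: coord4P; rewrite !rules; ring.
Qed.

End Flat.

(** Cramer's rule: if c and c' are both independent of m, then c lies in the
    span of c' and m, with a nonzero coefficient on c'. *)
Lemma span_of_wedge (R : fieldType) (r ma mb ca cb ca' cb' : R) :
  r != 0 -> r * ma * cb - r * mb * ca != 0 -> ma * cb' - mb * ca' != 0 ->
  exists y z, [/\ y != 0, ca = y * ca' + z * ma & cb = y * cb' + z * mb].
Proof.
move=> r0 D D'; exists ((ma * cb - mb * ca) / (ma * cb' - mb * ca')).
exists ((ca * cb' - cb * ca') / (ma * cb' - mb * ca')); split; [|by field|by field].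
rewrite mulf_neq0 ?invr_eq0 //.
by apply: contra_neq D => D0; rewrite -!mulrA -mulrBr D0 mulr0.
Qed.

Lemma wedge_eq0 (R : fieldType) (r ma mb ca cb : R) : (ma != 0) || (mb != 0) -> r != 0 ->
  r * ma * cb - r * mb * ca = 0 -> exists z, ca = z * ma /\ cb = z * mb.
Proof.
move=> m0 r0 D.
have {}D : ma * cb = mb * ca.
  by apply: (mulfI r0); rewrite !mulrA; apply/eqP; rewrite -subr_eq0 D.
have [ma0|ma0] := eqVneq ma 0; last first.
  exists (ca / ma); rewrite divfK //; split=> //; apply: (mulfI ma0).
  by rewrite D; field.
move: m0; rewrite ma0 eqxx /= => mb0; exists (cb / mb); rewrite divfK //.
by split=> //; apply: (mulfI mb0); rewrite -D ma0 !mul0r !mulr0.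
Qed.

Section Classification.
Context {R : realType} {g : lieAlgType R} (J E : 'End(g)).
Hypothesis dimg : \dim {: g} = 4%N.

Let in_list (h : lieAlgType R) (L : set ('End(h) * 'End(h))) :=
  exists p, L p /\ cps_equiv J E p.1 p.2.

(** The angle is read off from m.  The structure has d = 0 if c is proportional
    to m.  Otherwise d = 1, except when cos (t / 2) = 0: there the model with
    d = 1 degenerates, and the exceptional one has the right invariants. *)
Lemma in_cps_gh1 e1 e2 ma mb ca cb : (ma != 0) || (mb != 0) ->
  normal_form J E e1 e2 ma mb 0 0 ca cb -> in_list (cps_gh1 R).
Proof.
move=> m0; have [|r [t [r0 tI mE mE']]] := @half_polar _ (- ma) mb.
  by rewrite oppr_eq0.
have {mE} mE : ma = r * - cos (t / 2) by rewrite mulrN -mE opprK.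
have [_ _ CS] := half_angle t; set C := cos (t / 2) in mE CS; set S := sin (t / 2) in mE' CS.
have tIn : (`[0, 2 * pi[%classic : set R) t by rewrite /= in_itv.
have C0S : (- C != 0) || (S != 0).
  by apply: contraTT m0; rewrite mE mE' => /norP[/negPn/eqP-> /negPn/eqP->]; rewrite mulr0 eqxx.
rewrite mE mE' => nf.
have r00 : r * 0 = 0 :> R by rewrite mulr0.
have [D|D] := eqVneq (r * - C * cb - r * S * ca) 0.
  have [z [cE cE']] := wedge_eq0 C0S r0 D.
  exists (endo_of (basis_gh1 R) J1, endo_of (basis_gh1 R) (E1 t 0)); split.
    by left; exists t => //; exists 0 => //; left.
  apply: (normal_form_equiv (e1 := e1) (e2 := e2)
    (x := r) (y := 1) (z := z) dimg r0 _ (gh1_normal_form t 0)).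
    exact: oner_neq0.
  by rewrite /= -/C -/S r00 !(mulr0, mul0r, add0r) -cE -cE'.
have [C0|C0] := eqVneq C 0.
  exists (endo_of (basis_gh1 R) J1, endo_of (basis_gh1 R) E1_exc); split.
    by right.
  have S0 : S != 0 by move: C0S; rewrite C0 oppr0 eqxx.
  have rS0 : r * S != 0 by rewrite mulf_neq0.
  have [||y [z [y0 cE cE']]] := @span_of_wedge _ (r * S) 0 1 ca cb (- 2) 0 rS0.
  - by move: D; rewrite C0 oppr0 mulr0 mulr0 mulr1.
  - by rewrite mulr0 mul1r sub0r opprK pnatr_eq0.
  apply: (normal_form_equiv (e1 := e1) (e2 := e2)
    (x := r * S) (y := y) (z := z) dimg rS0 y0 (gh1_exc_normal_form R)).
  by rewrite -cE -cE' !mulr0 mulr1; move: nf; rewrite C0 oppr0 mulr0.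
exists (endo_of (basis_gh1 R) J1, endo_of (basis_gh1 R) (E1 t 1)); split.
  by left; exists t => //; exists 1 => //; right.
have [||y [z [y0 cE cE']]] :=
  @span_of_wedge _ r (- C) S ca cb (- 2 * 1 * C * S) (- 2 * 1 * C ^+ 2) r0.
- exact: D.
- have -> : - C * (- 2 * 1 * C ^+ 2) - S * (- 2 * 1 * C * S) =
    2 * C * (C ^+ 2 + S ^+ 2) by ring.
  by rewrite CS mulr1 mulf_neq0 // pnatr_eq0.
apply: (normal_form_equiv (e1 := e1) (e2 := e2)
    (x := r) (y := y) (z := z) dimg r0 y0 (gh1_normal_form t 1)).
by rewrite /= -/C -/S r00 -cE -cE'.
Qed.

Lemma in_cps_gh2 e1 e2 ma mb ca cb : (ma != 0) || (mb != 0) ->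
  normal_form J E e1 e2 ma mb (- ma) (- mb) ca cb -> in_list (cps_gh2 R).
Proof.
move=> m0; have [r [t [r0 tI mE mE']]] := half_polar m0.
have [_ _ CS] := half_angle t; set C := cos (t / 2) in mE CS; set S := sin (t / 2) in mE' CS.
have tIn : (`[0, 2 * pi[%classic : set R) t by rewrite /= in_itv.
have C0S : (C != 0) || (S != 0).
  by apply: contraTT m0; rewrite mE mE' => /norP[/negPn/eqP-> /negPn/eqP->]; rewrite mulr0 eqxx.
rewrite mE mE' -!mulrN => nf.
have [D|D] := eqVneq (r * C * cb - r * S * ca) 0.
  have [z [cE cE']] := wedge_eq0 C0S r0 D.
  exists (endo_of (basis_gh2 R) J2, endo_of (basis_gh2 R) (E2 t 0)); split.
    by left; exists t => //; exists 0 => //; left.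
  apply: (normal_form_equiv (e1 := e1) (e2 := e2)
    (x := r) (y := 1) (z := z) dimg r0 _ (gh2_normal_form t 0)).
    exact: oner_neq0.
  by rewrite /= -/C -/S !(mulr0, mul0r, add0r) -cE -cE'.
have [C0|C0] := eqVneq C 0.
  exists (endo_of (basis_gh2 R) J2, endo_of (basis_gh2 R) E2_exc); split.
    by right.
  have S0 : S != 0 by move: C0S; rewrite C0 eqxx.
  have rS0 : r * S != 0 by rewrite mulf_neq0.
  have [||y [z [y0 cE cE']]] := @span_of_wedge _ (r * S) 0 1 ca cb (- 3) 0 rS0.
  - by move: D; rewrite C0 !mulr0 mulr1.
  - by rewrite mulr0 mul1r sub0r opprK pnatr_eq0.
  apply: (normal_form_equiv (e1 := e1) (e2 := e2)
    (x := r * S) (y := y) (z := z) dimg rS0 y0 (gh2_exc_normal_form R)).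
  by rewrite -cE -cE' !mulr0 mulrN mulr1; move: nf; rewrite C0 oppr0 !mulr0 mulrN.
exists (endo_of (basis_gh2 R) J2, endo_of (basis_gh2 R) (E2 t 1)); split.
  by left; exists t => //; exists 1 => //; right.
have [||y [z [y0 cE cE']]] :=
  @span_of_wedge _ r C S ca cb (- 3 * 1 * C ^+ 2 * S) (3 * 1 * C ^+ 3) r0.
- exact: D.
- have -> : C * (3 * 1 * C ^+ 3) - S * (- 3 * 1 * C ^+ 2 * S) =
    3 * C ^+ 2 * (C ^+ 2 + S ^+ 2) by ring.
  by rewrite CS mulr1 mulf_neq0 ?pnatr_eq0 // expf_neq0.
apply: (normal_form_equiv (e1 := e1) (e2 := e2)
    (x := r) (y := y) (z := z) dimg r0 y0 (gh2_normal_form t 1)).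
by rewrite /= -/C -/S -cE -cE'.
Qed.

Lemma classification : underlying_cps J E ->
  [\/ in_list (cps_flat (basis_flat R)), in_list (cps_gh0 R), in_list (cps_gh1 R) |
      in_list (cps_gh2 R)].
Proof.
move=> /(normal_form_exists dimg)[e1 [e2 [ma [mb [ka [kb [ca [cb nf]]]]]]]].
have [m0|] := boolP ((ma != 0) || (mb != 0)).
  have [_ _ k] := nf; case: k => -[ka0 kb0]; rewrite ka0 kb0 in nf.
    by constructor 3; exact: in_cps_gh1 nf.
  by constructor 4; exact: in_cps_gh2 nf.
move=> /norP[/negPn/eqP ma0 /negPn/eqP mb0].
have [ka0 kb0] : ka = 0 /\ kb = 0.
  by have [_ _] := nf; rewrite ma0 mb0 oppr0; case.
rewrite ma0 mb0 ka0 kb0 in nf.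
have r00 : 1 * 0 = 0 :> R by rewrite mulr0.
have [c0|] := boolP ((- cb != 0) || (- ca != 0)).
  constructor 2; have [y [t [y0 tI cE cE']]] := half_polar c0.
  exists (endo_of (basis_gh0 R) J0, endo_of (basis_gh0 R) (E0 t)); split.
    by exists t => //; rewrite /= in_itv.
  apply: (normal_form_equiv (e1 := e1) (e2 := e2)
    (x := 1) (y := y) (z := 0) dimg _ y0 (gh0_normal_form t)).
    exact: oner_neq0.
  by rewrite r00 mulr0 !addr0 !mulrN -cE -cE' !opprK.
rewrite negb_or !negbK !oppr_eq0 => /andP[/eqP cb0 /eqP ca0].
constructor 1; exists (endo_of (basis_flat R) Jflat, endo_of (basis_flat R) Eflat).
split=> //.
apply: (normal_form_equiv (e1 := e1) (e2 := e2)
    (x := 1) (y := 1) (z := 0) dimg _ _ (flat_normal_form R));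
  try exact: oner_neq0.
by rewrite r00 mulr0 addr0; rewrite ca0 cb0 in nf.
Qed.

End Classification.

(** * Inequivalence of the models *)

Lemma cos_sin_inj (R : realType) (t t' : R) : 0 <= t < 2 * pi -> 0 <= t' < 2 * pi ->
  cos t = cos t' -> sin t = sin t' -> t = t'.
Proof.
wlog le_tt : t t' / t <= t'.
  move=> H tI tI' ce se; have [|/ltW] := leP t t' => ?; first exact: H.
  by apply/esym/H.
move=> /andP[t0 _] /andP[_ t'pi] ce se.
have : cos (t' - t) = 1.
  by rewrite cosB ce se -!expr2 cos2Dsin2.
have [-> _ CS] := half_angle (t' - t) => e.
have /eqP : sin ((t' - t) / 2) ^+ 2 = 0 by lra.
rewrite expf_eq0 /= => /eqP s0.
apply/eqP; rewrite eq_le le_tt /= leNgt; apply/negP => lt_tt.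
have : 0 < sin ((t' - t) / 2).
  by apply: sin_gt0_pi; rewrite divr_gt0 ?subr_gt0 //= ltr_pdivrMr // mulrC; lra.
by rewrite s0 ltxx.
Qed.

Section Rigidity.
Context {R : realType} {h : lieAlgType R} (J E J' E' : 'End(h)) (xi : 'Hom(h, h)).
Hypotheses (xiJ : forall x, xi (J x) = J' (xi x)) (xiE : forall x, xi (E x) = E' (xi x)).

(** A functional that xi rescales satisfies the same linear relation with its
    composites with E and J on both sides. *)
Lemma angle_rigid (phi : h -> R) k x0 x1 c s c' s' :
  (forall x, phi (xi x) = k * phi x) -> k != 0 ->
  (forall x, phi (E x) = c * phi x + s * phi (J x)) ->
  (forall x, phi (E' x) = c' * phi x + s' * phi (J' x)) ->
  phi x0 = 1 -> phi (J x0) = 0 -> phi x1 = 0 -> phi (J x1) = 1 ->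
  c = c' /\ s = s'.
Proof.
move=> phi_xi k0 phiE phiE' p0 pJ0 p1 pJ1.
have H x : c * phi x + s * phi (J x) = c' * phi x + s' * phi (J x).
  apply: (mulfI k0); rewrite -phiE -phi_xi xiE phiE' -xiJ !phi_xi; ring.
by have := H x0; have := H x1; rewrite p0 pJ0 p1 pJ1; split; lra.
Qed.

(** The deviation of x from the relation E x = s J x - c x.  For the c and s
    given by the angle, its vanishing on a suitable vector x characterizes the
    structures that occur with d = 0. *)
Definition defect (J0 E0 : 'End(h)) (c s : R) x := E0 x - s *: J0 x + c *: x.

Lemma defect_rigid c s x : xi (defect J E c s x) = defect J' E' c s (xi x).
Proof. by rewrite /defect linearD linearB !linearZ /= xiJ xiE. Qed.

End Rigidity.

Section ModelRigidity.
Variable R : realType.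

Lemma v_coordE k (x := v_ R k) :
  (x@0 = (0 == k)%N%:R) * (x@1 = (1 == k)%N%:R) * (x@2 = (2 == k)%N%:R) *
  (x@3 = (3 == k)%N%:R).
Proof. by do !split; exact: v_E. Qed.

Let scale_neq0 (h : lieAlgType R) (phi : h -> R) (xi : 'Hom(h, h)) v0 :
  bijective xi -> phi v0 = 1 -> (forall x, phi (xi x) = phi (xi v0) * phi x) ->
  phi (xi v0) != 0.
Proof.
move=> [f _ fK] p0 H; apply/eqP => k0.
by have := H (f v0); rewrite fK p0 k0 mul0r => /eqP; rewrite oner_eq0.
Qed.

(** An automorphism preserves the derived algebra, which is the kernel of the
    v_0 coordinate, hence rescales that coordinate. *)
Lemma lie_iso_gh1 (xi : 'Hom(gh1 R, gh1 R)) : lie_isomorphism xi ->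
  forall x : gh1 R, (xi x)@0 = (xi (v_ R 0))@0 * x@0.
Proof.
move=> [_ xiL] x.
have -> : x = x@0 *: (v_ R 0 : gh1 R) +
    lie (v_ R 0 : gh1 R) (vec 0 x@1 (- x@2) (- x@3) : gh1 R).
  by apply: coord4P; rewrite !(linE, lie_gh1E, vecE, v_coordE) /=; ring.
rewrite linearD linearZ /= xiL !(linE, lie_gh1E, vecE, v_coordE) /=; ring.
Qed.

Lemma lie_iso_gh2 (xi : 'Hom(gh2 R, gh2 R)) : lie_isomorphism xi ->
  forall x : gh2 R, (xi x)@0 = (xi (v_ R 0))@0 * x@0.
Proof.
move=> [_ xiL] x.
have -> : x = x@0 *: (v_ R 0 : gh2 R) +
    lie (v_ R 0 : gh2 R) (vec 0 (x@1 / 2) (- x@2) x@3 : gh2 R).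
  by apply: coord4P; rewrite !(linE, lie_gh2E, vecE, v_coordE) /=; field.
rewrite linearD linearZ /= xiL !(linE, lie_gh2E, vecE, v_coordE) /=; ring.
Qed.

Lemma lie_iso_gh0 (xi : 'Hom(gh0 R, gh0 R)) : lie_isomorphism xi ->
  exists2 k, k != 0 & xi (v_ R 3) = k *: (v_ R 3 : gh0 R).
Proof.
move=> [[f xiK fK] xiL].
have e : v_ R 3 = lie (v_ R 1 : gh0 R) (v_ R 2 : gh0 R).
  by apply: coord4P; rewrite !(lie_gh0E, vecE, v_coordE) /=; ring.
have xi3 : xi (v_ R 3) = (xi (v_ R 3))@3 *: (v_ R 3 : gh0 R).
  by apply: coord4P; rewrite {1}e xiL !(linE, lie_gh0E, vecE, v_coordE) /= ?e ?xiL ?lie_gh0E; ring.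
exists ((xi (v_ R 3))@3) => //; apply/eqP => k0; move: xi3; rewrite k0 scale0r => xi3.
have : f (xi (v_ R 3)) = f (xi 0) by rewrite xi3 linear0.
rewrite !xiK => /(congr1 (fun x : gh0 R => x@3)); rewrite !(linE, vecE, v_coordE) /=.
by move/eqP; rewrite oner_eq0.
Qed.

Lemma gh0_rigid t t' : 0 <= t < 2 * pi -> 0 <= t' < 2 * pi ->
  cps_equiv (endo_of (basis_gh0 R) J0) (endo_of (basis_gh0 R) (E0 t))
            (endo_of (basis_gh0 R) J0) (endo_of (basis_gh0 R) (E0 t')) ->
  t = t'.
Proof.
move=> tI tI' [xi [/lie_iso_gh0[k k0 xi3] xiJ xiE]].
set J := endo_of _ J0 in xiJ.
have EE u : endo_of (basis_gh0 R) (E0 u) (v_ R 3) =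
    cos u *: (v_ R 3 : gh0 R) + sin u *: J (v_ R 3).
  by apply: coord4P; rewrite /J /E0 /J0 !(linE, endo_gh0E, row4E, vecE, v_coordE) /=; ring.
have := xiE (v_ R 3); rewrite xi3 linearZ /= !EE linearD !linearZ /= xiJ xi3 linearZ /=.
move=> e.
have e0 := congr1 (fun x : gh0 R => x@0) e.
have e3 := congr1 (fun x : gh0 R => x@3) e.
rewrite /J /J0 !(linE, endo_gh0E, row4E, vecE, v_coordE) /= in e0 e3.
by apply: cos_sin_inj => //; apply: (mulfI k0); lra.
Qed.

Definition gh1_angle c s (E : 'End(gh1 R)) := forall x : gh1 R,
  (E x)@0 = c * x@0 + s * (endo_of (basis_gh1 R) J1 x)@0.

(** The defect is taken on v_1, the eigenvector of ad v_0 for the simple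
    eigenvalue.  An automorphism xi preserves its line: if xi v_0 had v_0
    coordinate k <> 1, then xi v_1 <> 0 would force k = - 1, and xi v_2, xi v_3
    would lie in the line of v_1, which cannot contain xi v_3 = J (xi v_2). *)
Lemma gh1_rigid E E' c s c' s' : gh1_angle c s E -> gh1_angle c' s' E' ->
  cps_equiv (endo_of (basis_gh1 R) J1) E (endo_of (basis_gh1 R) J1) E' ->
  [/\ c = c', s = s' &
      (defect (endo_of (basis_gh1 R) J1) E c s (v_ R 1) = 0 <->
       defect (endo_of (basis_gh1 R) J1) E' c s (v_ R 1) = 0)].
Proof.
set J := endo_of _ J1 => phiE phiE' [xi [xiI xiJ xiE]].
have phi_xi := lie_iso_gh1 xiI; set k := (xi (v_ R 0))@0 in phi_xi.
have k0 : k != 0.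
  by apply: (@scale_neq0 _ (fun x : gh1 R => x@0)) phi_xi; [case: xiI|rewrite v_coordE].
have [cc ss] : c = c' /\ s = s'.
  apply: (angle_rigid (phi := fun x : gh1 R => x@0) (x0 := v_ R 0) (x1 := - (v_ R 1 : gh1 R))
    xiJ xiE phi_xi k0 phiE phiE');
    rewrite /J /J1 ?linearN /= !(linE, endo_gh1E, row4E, vecE, v_coordE) /=; ring.
split=> //.
have [[f xiK fK] xiL] := xiI.
have br v l : lie (v_ R 0 : gh1 R) v = l *: v -> lie (xi (v_ R 0)) (xi v) = l *: xi v.
  by move=> e; rewrite -xiL e linearZ.
have w1 := br (v_ R 1) 1; have w2 := br (v_ R 2) (- 1).
have {}w1 : lie (xi (v_ R 0)) (xi (v_ R 1)) = 1 *: xi (v_ R 1).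
  by apply: w1; apply: coord4P; rewrite !(linE, lie_gh1E, vecE, v_coordE) /=; ring.
have {}w2 : lie (xi (v_ R 0)) (xi (v_ R 2)) = (- 1) *: xi (v_ R 2).
  by apply: w2; apply: coord4P; rewrite !(linE, lie_gh1E, vecE, v_coordE) /=; ring.
have z1 : (xi (v_ R 1))@0 = 0 by rewrite phi_xi v_coordE mulr0.
have z2 : (xi (v_ R 2))@0 = 0 by rewrite phi_xi v_coordE mulr0.
have z3 : (xi (v_ R 3))@0 = 0 by rewrite phi_xi v_coordE mulr0.
have xi_eq0 v : xi v = 0 -> v = 0.
  by move=> xv; apply: (can_inj xiK); rewrite xv linear0.
have std0 (j : nat) : (j < 4)%N -> (v_ R j : gh1 R) <> 0.
  case: j => [|[|[|[|//]]]] _ e; [have := congr1 (fun x : gh1 R => x@0) e|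
    have := congr1 (fun x : gh1 R => x@1) e|have := congr1 (fun x : gh1 R => x@2) e|
    have := congr1 (fun x : gh1 R => x@3) e]; rewrite !(linE, vecE, v_coordE) /= => /eqP;
  by rewrite oner_eq0.
(* ad (xi v_0) acts on the derived algebra as k diag (1, - 1, - 1), and xi v_1 is
   a fixed vector of it. *)
have k1 : k = 1.
  have c1 i := congr1 (fun x : gh1 R => x@i) w1.
  have c2 i := congr1 (fun x : gh1 R => x@i) w2.
  have := c1 1%N; have := c1 2%N; have := c1 3%N; have := c2 2%N; have := c2 3%N.
  rewrite !(linE, lie_gh1E) -/k z1 z2 => e23 e22 e13 e12 e11.
  apply/eqP; rewrite -subr_eq0; apply/negPn/negP => kN1.
  have a1 : (xi (v_ R 1))@1 = 0 by apply: (mulfI kN1); lra.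
  have [kE|kE] := eqVneq (k + 1) 0; last first.
    apply: (std0 1%N isT); apply: xi_eq0; apply: coord4P; rewrite !linE //.
      by apply: (mulfI kE); lra.
    by apply: (mulfI kE); lra.
  have b2 : (xi (v_ R 2))@2 = 0 by have := e22; rewrite (_ : k = - 1); lra.
  have b3 : (xi (v_ R 2))@3 = 0 by have := e23; rewrite (_ : k = - 1); lra.
  have J2 : J (v_ R 2) = v_ R 3.
    by apply: coord4P; rewrite /J /J1 !(endo_gh1E, row4E, vecE, v_coordE) /=; ring.
  have := z3; rewrite -J2 xiJ /J /J1 !(endo_gh1E, row4E) => b1.
  by apply: (std0 2%N isT); apply: xi_eq0; apply: coord4P; rewrite !linE //; lra.
have [l xi1] : exists l, xi (v_ R 1) = l *: (v_ R 1 : gh1 R).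
  exists ((xi (v_ R 1))@1).
  have c1 i := congr1 (fun x : gh1 R => x@i) w1.
  have := c1 2%N; have := c1 3%N; rewrite !(linE, lie_gh1E) -/k z1 k1 => e13 e12.
  by apply: coord4P; rewrite !(linE, vecE, v_coordE) /=; lra.
have l0 : l != 0.
  by apply/eqP => l0; apply: (std0 1%N isT); apply: xi_eq0; rewrite xi1 l0 scale0r.
have H : xi (defect J E c s (v_ R 1)) = l *: defect J E' c s (v_ R 1).
  by rewrite (defect_rigid xiJ xiE) xi1 /defect !linearZ /=; module.
split=> e; last by apply: xi_eq0; rewrite H e scaler0.
by move/eqP: H; rewrite e linear0 eq_sym scaler_eq0 (negbTE l0) => /eqP.
Qed.

Lemma gh1_angleE t d :
  gh1_angle (cos t) (- sin t) (endo_of (basis_gh1 R) (E1 t d)).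
Proof. by move=> x; rewrite /E1 /J1 !(endo_gh1E, row4E); ring. Qed.

Lemma gh1_angle_exc : gh1_angle (- 1) 0 (endo_of (basis_gh1 R) E1_exc).
Proof. by move=> x; rewrite /E1_exc /J1 !(endo_gh1E, row4E); ring. Qed.

Lemma gh1_defectE t d :
  defect (endo_of (basis_gh1 R) J1) (endo_of (basis_gh1 R) (E1 t d))
    (cos t) (- sin t) (v_ R 1) = vec 0 0 (d * (1 + cos t)) (d * sin t).
Proof.
by apply: coord4P; rewrite /defect /E1 /J1 !(linE, endo_gh1E, row4E, vecE, v_coordE) /=; ring.
Qed.

Lemma gh1_defect_exc :
  defect (endo_of (basis_gh1 R) J1) (endo_of (basis_gh1 R) E1_exc) (- 1) 0 (v_ R 1)
  = vec 0 0 0 2.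
Proof.
by apply: coord4P; rewrite /defect /E1_exc /J1 !(linE, endo_gh1E, row4E, vecE, v_coordE) /=; ring.
Qed.

End ModelRigidity.

Section ModelRigidity2.
Variable R : realType.

Definition gh2_angle c s (E : 'End(gh2 R)) :=
  (forall x : gh2 R, (E x)@0 = c * x@0 + s * (endo_of (basis_gh2 R) J2 x)@0) /\
  defect (endo_of (basis_gh2 R) J2) E c s (v_ R 3) = 0.

(** The defect is taken on v_2, whose line is preserved by automorphisms modulo
    v_3; the defect of v_3 is always zero, so that this ambiguity is
    harmless. *)
Lemma gh2_rigid E E' c s c' s' : gh2_angle c s E -> gh2_angle c' s' E' ->
  cps_equiv (endo_of (basis_gh2 R) J2) E (endo_of (basis_gh2 R) J2) E' ->
  [/\ c = c', s = s' &
      (defect (endo_of (basis_gh2 R) J2) E c s (v_ R 2) = 0 <->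
       defect (endo_of (basis_gh2 R) J2) E' c s (v_ R 2) = 0)].
Proof.
set J := endo_of _ J2 => -[phiE _] [phiE' def3] [xi [xiI xiJ xiE]].
have phi_xi := lie_iso_gh2 xiI; set k := (xi (v_ R 0))@0 in phi_xi.
have [[f xiK fK] xiL] := xiI.
have k0 : k != 0.
  apply/eqP => k0; have := phi_xi (f (v_ R 0 : gh2 R)).
  by rewrite fK k0 mul0r v_coordE => /eqP; rewrite oner_eq0.
have [cc ss] : c = c' /\ s = s'.
  apply: (angle_rigid (phi := fun x : gh2 R => x@0) (x0 := v_ R 0) (x1 := v_ R 2)
    xiJ xiE phi_xi k0 phiE phiE');
    rewrite /J /J2 !(linE, endo_gh2E, row4E, vecE, v_coordE) /=; ring.
rewrite -cc -ss in def3; split=> //.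
have w2 : lie (xi (v_ R 0)) (xi (v_ R 2)) = - xi (v_ R 2).
  rewrite -xiL -linearN; congr (xi _).
  by apply: coord4P; rewrite !(linE, lie_gh2E, vecE, v_coordE) /=; ring.
have w3 : lie (xi (v_ R 0)) (xi (v_ R 3)) = xi (v_ R 3).
  rewrite -xiL; congr (xi _).
  by apply: coord4P; rewrite !(linE, lie_gh2E, vecE, v_coordE) /=; ring.
have w12 : xi (v_ R 3) = lie (xi (v_ R 1)) (xi (v_ R 2)).
  rewrite -xiL; congr (xi _).
  by apply: coord4P; rewrite !(linE, lie_gh2E, vecE, v_coordE) /=; ring.
have z1 : (xi (v_ R 1))@0 = 0 by rewrite phi_xi v_coordE mulr0.
have z2 : (xi (v_ R 2))@0 = 0 by rewrite phi_xi v_coordE mulr0.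
have xi_eq0 v : xi v = 0 -> v = 0.
  by move=> xv; apply: (can_inj xiK); rewrite xv linear0.
have [l xi3] : exists l, xi (v_ R 3) = l *: (v_ R 3 : gh2 R).
  exists ((xi (v_ R 3))@3).
  by apply: coord4P; rewrite w12 !(linE, lie_gh2E, vecE, v_coordE) /= z1 z2; ring.
have l0 : l != 0.
  apply/eqP => l0; have := xi_eq0 (v_ R 3); rewrite xi3 l0 scale0r => /(_ erefl).
  move/(congr1 (fun x : gh2 R => x@3)); rewrite !(linE, vecE, v_coordE) /= => /eqP.
  by rewrite oner_eq0.
have k1 : k = 1.
  apply: (mulIf l0); have := congr1 (fun x : gh2 R => x@3) w3.
  rewrite xi3 !(linE, lie_gh2E, vecE, v_coordE) -/k /=; lra.
have [p [q xi2]] : exists p q, xi (v_ R 2) = p *: (v_ R 2 : gh2 R) + q *: (v_ R 3 : gh2 R).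
  exists ((xi (v_ R 2))@2), ((xi (v_ R 2))@3).
  have := congr1 (fun x : gh2 R => x@1) w2; rewrite !(linE, lie_gh2E) -/k z2 k1 => e.
  by apply: coord4P; rewrite !(linE, vecE, v_coordE) /=; lra.
have p0 : p != 0.
  apply/eqP => p0; have : xi (v_ R 2) = xi ((q / l) *: (v_ R 3 : gh2 R)).
    by rewrite linearZ /= xi3 scalerA divfK // xi2 p0 scale0r add0r.
  move/(can_inj xiK)/(congr1 (fun x : gh2 R => x@2)); rewrite !(linE, vecE, v_coordE) /=.
  by rewrite mulr0 => /eqP; rewrite oner_eq0.
have H : xi (defect J E c s (v_ R 2)) = p *: defect J E' c s (v_ R 2).
  rewrite (defect_rigid xiJ xiE) xi2 -[RHS]addr0 -(scaler0 _ q) -def3 /defect.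
  by rewrite !linearD !linearZ /=; module.
split=> e; last by apply: xi_eq0; rewrite H e scaler0.
by move/eqP: H; rewrite e linear0 eq_sym scaler_eq0 (negbTE p0) => /eqP.
Qed.

Lemma gh2_angleE t d : gh2_angle (cos t) (sin t) (endo_of (basis_gh2 R) (E2 t d)).
Proof.
split; first by move=> x; rewrite /E2 /J2 !(endo_gh2E, row4E); ring.
by apply: coord4P; rewrite /defect /E2 /J2 !(linE, endo_gh2E, row4E, vecE, v_coordE) /=; ring.
Qed.

Lemma gh2_angle_exc : gh2_angle (- 1) 0 (endo_of (basis_gh2 R) E2_exc).
Proof.
split; first by move=> x; rewrite /E2_exc /J2 !(endo_gh2E, row4E); ring.
by apply: coord4P; rewrite /defect /E2_exc /J2 !(linE, endo_gh2E, row4E, vecE, v_coordE) /=; ring.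
Qed.

Lemma gh2_defectE t d :
  defect (endo_of (basis_gh2 R) J2) (endo_of (basis_gh2 R) (E2 t d))
    (cos t) (sin t) (v_ R 2) =
  vec 0 (- (d * (1 + cos t)) * cos t) 0 (d * (1 + cos t) * sin t).
Proof.
by apply: coord4P; rewrite /defect /E2 /J2 !(linE, endo_gh2E, row4E, vecE, v_coordE) /=; ring.
Qed.

Lemma gh2_defect_exc :
  defect (endo_of (basis_gh2 R) J2) (endo_of (basis_gh2 R) E2_exc) (- 1) 0 (v_ R 2)
  = vec 0 2 0 0.
Proof.
by apply: coord4P; rewrite /defect /E2_exc /J2 !(linE, endo_gh2E, row4E, vecE, v_coordE) /=; ring.
Qed.

End ModelRigidity2.

Section Lists.
Variable R : realType.

Definition inequivalent (h : lieAlgType R) (L : set ('End(h) * 'End(h))) :=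
  forall p q, L p -> L q -> cps_equiv p.1 p.2 q.1 q.2 -> p = q.

Lemma cps_gh0_inequivalent : inequivalent (cps_gh0 R).
Proof.
move=> _ _ [t + <-] [t' + <-]; rewrite /= !in_itv /= => tI tI'.
by move=> /(gh0_rigid tI tI') ->.
Qed.

(** When the defect of a member with parameter d vanishes, the member also
    occurs with d = 0; this happens for d = 1 at t = pi. *)
Lemma E1_collapse t (d : R) : d * (1 + cos t) = 0 -> d * sin t = 0 -> E1 t d = E1 t 0.
Proof. by move=> dc ds; rewrite /E1 !mulNr dc ds !mul0r. Qed.

Lemma E2_collapse t (d : R) : d * (1 + cos t) = 0 -> E2 t d = E2 t 0.
Proof.
move=> dc; rewrite /E2; congr (mx4 [:: _; _; [:: _; _; _; _]; [:: _; _; _; _]]).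
- by rewrite mulrAC dc !mul0r.
- by rewrite !mulNr mulrAC dc !mul0r.
- by rewrite mulrAC dc !mul0r.
- by rewrite mulrAC dc !mul0r.
Qed.

Lemma cps_gh1_inequivalent : inequivalent (cps_gh1 R).
Proof.
have defE t (d : R) : vec 0 0 (d * (1 + cos t)) (d * sin t) = 0 -> E1 t d = E1 t 0.
  by case/vec_eq0 => _ _ dc ds; apply: E1_collapse.
have exc_neq t d : cps_equiv (endo_of (basis_gh1 R) J1) (endo_of (basis_gh1 R) (E1 t d))
    (endo_of (basis_gh1 R) J1) (endo_of (basis_gh1 R) E1_exc) -> False.
  move=> /(gh1_rigid (gh1_angleE t d) (@gh1_angle_exc R))[ct st].
  rewrite gh1_defectE ct st gh1_defect_exc; move/eqP: st; rewrite oppr_eq0 => /eqP->.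
  rewrite subrr !mulr0 => -[/(_ _)/vec_eq0[|_ _ _]]; first exact/vec_eq0.
  by move/eqP; rewrite pnatr_eq0.
move=> _ _ [[t tI [d dI <-]]|->] [[t' tI' [d' dI' <-]]|->] //=.
- move: tI tI'; rewrite /= !in_itv /= => tI tI'.
  move=> /(gh1_rigid (gh1_angleE t d) (gh1_angleE t' d'))[ct /oppr_inj st].
  have {t' tI' ct st} <- := cos_sin_inj tI tI' ct st.
  rewrite !gh1_defectE => dd; congr (_, endo_of _ _).
  move: dd; case: dI dI' => -> [] -> dd //.
    by rewrite [RHS]defE //; apply/dd; rewrite !mul0r; exact/vec_eq0.
  by rewrite [LHS]defE //; apply/dd; rewrite !mul0r; exact/vec_eq0.
- by move=> /exc_neq.
- by move=> /cps_equiv_common /(_ (cps_equiv_refl _ _)) /exc_neq.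
Qed.

Lemma cps_gh2_inequivalent : inequivalent (cps_gh2 R).
Proof.
have defE t (d : R) : vec 0 (- (d * (1 + cos t)) * cos t) 0 (d * (1 + cos t) * sin t) = 0 ->
    E2 t d = E2 t 0.
  case/vec_eq0 => _ dc _ ds; apply: E2_collapse.
  by apply: (@circle_free _ (cos t) (sin t)); rewrite ?cos2Dsin2 //; lra.
have exc_neq t d : cps_equiv (endo_of (basis_gh2 R) J2) (endo_of (basis_gh2 R) (E2 t d))
    (endo_of (basis_gh2 R) J2) (endo_of (basis_gh2 R) E2_exc) -> False.
  move=> /(gh2_rigid (gh2_angleE t d) (@gh2_angle_exc R))[ct st].
  rewrite gh2_defectE ct st gh2_defect_exc.
  rewrite subrr !(mulr0, mul0r, oppr0) => -[/(_ _)/vec_eq0[|_ + _ _]]; first exact/vec_eq0.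
  by move/eqP; rewrite pnatr_eq0.
move=> _ _ [[t tI [d dI <-]]|->] [[t' tI' [d' dI' <-]]|->] //=.
- move: tI tI'; rewrite /= !in_itv /= => tI tI'.
  move=> /(gh2_rigid (gh2_angleE t d) (gh2_angleE t' d'))[ct st].
  have {t' tI' ct st} <- := cos_sin_inj tI tI' ct st.
  rewrite !gh2_defectE => dd; congr (_, endo_of _ _).
  move: dd; case: dI dI' => -> [] -> dd //.
    by rewrite [RHS]defE //; apply/dd; rewrite !(mul0r, oppr0); exact/vec_eq0.
  by rewrite [LHS]defE //; apply/dd; rewrite !(mul0r, oppr0); exact/vec_eq0.
- by move=> /exc_neq.
- by move=> /cps_equiv_common /(_ (cps_equiv_refl _ _)) /exc_neq.
Qed.

Lemma cps_gh0_underlying p : cps_gh0 R p -> underlying_cps p.1 p.2.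
Proof. by case=> t _ <-; apply: normal_form_underlying (gh0_normal_form t). Qed.

Lemma cps_gh1_underlying p : cps_gh1 R p -> underlying_cps p.1 p.2.
Proof.
case=> [[t _ [d _ <-]]|->]; first exact: normal_form_underlying (gh1_normal_form t d).
exact: normal_form_underlying (gh1_exc_normal_form R).
Qed.

Lemma cps_gh2_underlying p : cps_gh2 R p -> underlying_cps p.1 p.2.
Proof.
case=> [[t _ [d _ <-]]|->]; first exact: normal_form_underlying (gh2_normal_form t d).
exact: normal_form_underlying (gh2_exc_normal_form R).
Qed.

End Lists.

Section Distinct.
Context {R : realType}.

Definition lie_abelian (g : lieAlgType R) := forall x y : g, lie x y = 0.
Definition lie_2step (g : lieAlgType R) := forall x y z : g, lie x (lie y z) = 0.
Definition lie_metabelian (g : lieAlgType R) :=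
  forall x y z t : g, lie (lie x y) (lie z t) = 0.

(** These three laws separate the four algebras: the abelian one, gh0, gh1 and
    gh2 satisfy three, two, one and none of them. *)
Lemma lie_isomorphic_laws (g h : lieAlgType R) : lie_isomorphic g h ->
  [/\ lie_abelian g <-> lie_abelian h, lie_2step g <-> lie_2step h &
      lie_metabelian g <-> lie_metabelian h].
Proof.
case=> xi xiI; have [zeta [[_ zetaL] xiK zetaK]] := lie_iso_inv xiI.
have xiL := xiI.2.
rewrite /lie_abelian /lie_2step /lie_metabelian; split;
  split=> H *; first [apply: (can_inj zetaK)|apply: (can_inj xiK)];
  by rewrite !(xiL, zetaL) H linear0.
Qed.

Lemma flat_laws : lie_abelian (abelian4 R).
Proof. exact: lie_flat. Qed.

Lemma gh0_laws : lie_2step (gh0 R) /\ ~ lie_abelian (gh0 R).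
Proof.
split=> [x y z|/(_ (v_ R 1) (v_ R 2))/(congr1 (fun x : gh0 R => x@3))].
  by apply: coord4P; rewrite !(linE, lie_gh0E); ring.
by rewrite !(linE, lie_gh0E, vecE, v_coordE) /= => /eqP; rewrite !mulr0 subr0 mulr1 oner_eq0.
Qed.

Lemma gh1_laws : lie_metabelian (gh1 R) /\ ~ lie_2step (gh1 R).
Proof.
split=> [x y z t|/(_ (v_ R 0) (v_ R 0) (v_ R 1))/(congr1 (fun x : gh1 R => x@1))].
  by apply: coord4P; rewrite !(linE, lie_gh1E); ring.
by rewrite !(linE, lie_gh1E, vecE, v_coordE) /= => e; apply/eqP: (oner_neq0 R); lra.
Qed.

Lemma gh2_laws : ~ lie_metabelian (gh2 R).
Proof.
move=> /(_ (v_ R 0) (v_ R 1) (v_ R 0) (v_ R 2))/(congr1 (fun x : gh2 R => x@3)).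
by rewrite !(linE, lie_gh2E, vecE, v_coordE) /= => e; apply/eqP: (oner_neq0 R); lra.
Qed.

End Distinct.

(** * The theorem *)

Lemma cps_equiv_isomorphic (R : realType) (g h : lieAlgType R) (J E : 'End(g))
    (J' E' : 'End(h)) : cps_equiv J E J' E' -> lie_isomorphic g h.
Proof. by case=> xi [xiI _ _]; exists xi. Qed.

Lemma parametrized_by_list (R : realType) (g h : lieAlgType R)
    (L : set ('End(h) * 'End(h))) :
  (forall p, L p -> underlying_cps p.1 p.2) -> inequivalent L ->
  (forall J E : 'End(g), underlying_cps J E ->
    exists p, L p /\ cps_equiv J E p.1 p.2) ->
  parametrized_by g h L.
Proof.
move=> Lcps Lineq gL; split=> // J E /gL[p [Lp Ep]].
exists p; split=> // q [Lq Eq]; apply: Lineq => //; exact: cps_equiv_common Ep Eq.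
Qed.

Theorem theorem5p1 (R : realType) (g : lieAlgType R) (dim_g : \dim {: g} = 4%N)
  (hs_g : exists (J E : 'End(g)) (m : {symmetric g}), hypersymplectic J E m) :
  [\/ lie_isomorphic g (abelian4 R), lie_isomorphic g (gh0 R),
      lie_isomorphic g (gh1 R) | lie_isomorphic g (gh2 R)] /\
  [/\ lie_isomorphic g (abelian4 R) ->
        exists X : 4.-tuple (abelian4 R),
          basis_of fullv X /\ parametrized_by g (abelian4 R) (cps_flat X),
      lie_isomorphic g (gh0 R) -> parametrized_by g (gh0 R) (cps_gh0 R),
      lie_isomorphic g (gh1 R) -> parametrized_by g (gh1 R) (cps_gh1 R) &
      lie_isomorphic g (gh2 R) -> parametrized_by g (gh2 R) (cps_gh2 R)].
Proof.
split.
  have [J [E [m hs]]] := hs_g.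
  have cps : underlying_cps J E by exists m.
  have [] := classification dim_g cps => -[p [_ /cps_equiv_isomorphic iso]].
  - by constructor 1.
  - by constructor 2.
  - by constructor 3.
  - by constructor 4.
have [ab0 nab0] := gh0_laws (R := R); have [ab1 nab1] := gh1_laws (R := R).
have ab := @flat_laws R; have nab2 := @gh2_laws R.
have st0 : lie_metabelian (gh0 R).
  by move=> x y z t; exact: ab0.
have law (h h' : lieAlgType R) : lie_isomorphic g h -> lie_isomorphic g h' ->
    [/\ lie_abelian h <-> lie_abelian h', lie_2step h <-> lie_2step h' &
        lie_metabelian h <-> lie_metabelian h'].
  move=> /lie_isomorphic_laws[a1 a2 a3] /lie_isomorphic_laws[b1 b2 b3].
  by split; [rewrite -a1|rewrite -a2|rewrite -a3].
have ab_2step : lie_2step (abelian4 R) by move=> x y z; exact: ab.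
have ab_met : lie_metabelian (abelian4 R) by move=> x y z t; exact: ab.
split=> iso.
- exists (basis_flat R); split; first exact: basis_flatP.
  apply: parametrized_by_list => [p ->|p q -> -> //|J E cps].
    exact: normal_form_underlying (flat_normal_form R).
  have [//|||] := classification dim_g cps => -[p [_ /cps_equiv_isomorphic iso']];
    have [h1 h2 h3] := law _ _ iso iso'; exfalso; tauto.
- apply: parametrized_by_list => [||J E cps]; first exact: cps_gh0_underlying.
    exact: cps_gh0_inequivalent.
  have [|//||] := classification dim_g cps => -[p [_ /cps_equiv_isomorphic iso']];
    have [h1 h2 h3] := law _ _ iso iso'; exfalso; tauto.
- apply: parametrized_by_list => [||J E cps]; first exact: cps_gh1_underlying.
    exact: cps_gh1_inequivalent.
  have [||//|] := classification dim_g cps => -[p [_ /cps_equiv_isomorphic iso']];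
    have [h1 h2 h3] := law _ _ iso iso'; exfalso; tauto.
- apply: parametrized_by_list => [||J E cps]; first exact: cps_gh2_underlying.
    exact: cps_gh2_inequivalent.
  have [|||//] := classification dim_g cps => -[p [_ /cps_equiv_isomorphic iso']];
    have [h1 h2 h3] := law _ _ iso iso'; exfalso; tauto.
Qed.
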